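(* Let $R$ be a commutative Noetherian ring with non-zero identity and $\mathfrak a$ an ideal of $R$. Let $M$ be a finitely generated $R$-module, $X$ an arbitrary $R$-module, and $m,n$ non-negative integers. Assume that (i) $\operatorname{Ext}^{m+n-r}_R(M,H^r_{\mathfrak a}(X))=0$ for all $r$ with $0\le r\le n-1$ or $n+1\le r\le m+n$, (ii) $\operatorname{Ext}^{m+1+r}_R(M,H^{n-r}_{\mathfrak a}(X))=0$ for all $r$ with $1\le r\le n$, and (iii) $\operatorname{Ext}^{m-1-r}_R(M,H^{n+r}_{\mathfrak a}(X))=0$ for all $r$ with $1\le r\le m-1$. Then $H^{m+n}_{\mathfrak a}(M,X)\cong\operatorname{Ext}^m_R(M,H^n_{\mathfrak a}(X))$.
   Context: $H^i_{\mathfrak a}(M,X)=\varinjlim_{k}\operatorname{Ext}^i_R(M/\mathfrak a^kM,X)$ is the $i$-th generalized local cohomology module, and $H^i_{\mathfrak a}(X)=H^i_{\mathfrak a}(R,X)$ is ordinary local cohomology. *)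

(* Defs.v *)
From HB Require Import structures.
From mathcomp Require Import all_boot all_algebra.
From mathcomp Require Import boolp functions freeg.

Set Implicit Arguments.
Unset Strict Implicit.
Unset Printing Implicit Defensive.

Import GRing.Theory.
Local Open Scope ring_scope.
Local Open Scope quotient_scope.

(* Membership predicates are boolean, as required by MathComp's subtypes and
   quotients; arbitrary propositions are turned into booleans by [asbool]. *)
Record submodule (R : comNzRingType) (V : lmodType R) := Submodule {
  submodule_pred :> {pred V};
  submodule_closed : submod_closed submodule_pred
}.
Arguments Submodule {R V} _ _.

HB.instance Definition _ (R : comNzRingType) (V : lmodType R)
    (N : submodule V) :=
  GRing.isSubmodClosed.Build R V (submodule_pred N) (submodule_closed N).

(* MathComp's [idealr] are proper ideals; here the unit ideal is allowed. *)
Notation ideal R := (submodule (R^o)).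

Section Submodules.
Variables (R : comNzRingType).
Implicit Types (V W : lmodType R).

Lemma ker_closed V W (f : {linear V -> W}) :
  submod_closed [pred v | f v == 0].
Proof.
split=> [|c u v]; rewrite !inE ?linear0 // => /eqP fu /eqP fv.
by rewrite linearP fu fv scaler0 addr0.
Qed.
Definition ker V W (f : {linear V -> W}) := Submodule _ (ker_closed f).

Lemma im_closed V W (f : {linear V -> W}) :
  submod_closed [pred w | `[< exists v, f v = w >]].
Proof.
split=> [|c _ _ /asboolP[u <-] /asboolP[v <-]]; apply/asboolP.
  by exists 0; rewrite linear0.
by exists (c *: u + v); rewrite linearP.
Qed.
Definition im V W (f : {linear V -> W}) := Submodule _ (im_closed f).

Lemma preim_closed V W (f : {linear V -> W}) (N : submodule W) :
  submod_closed [pred v | f v \in N].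
Proof.
by split=> [|c u v]; rewrite !inE ?linear0 ?rpred0 // linearP => fu fv;
   rewrite rpredD ?rpredZ.
Qed.
Definition preim_sub V W (f : {linear V -> W}) (N : submodule W) :=
  Submodule _ (preim_closed f N).

Lemma zero_closed V : submod_closed [pred v : V | v == 0].
Proof.
by split=> [|c u v]; rewrite !inE // => /eqP-> /eqP->; rewrite scaler0 addr0.
Qed.
Definition zero_sub V := Submodule _ (@zero_closed V).

Lemma full_closed V : submod_closed (predT : {pred V}).
Proof. by []. Qed.
Definition full_sub V := Submodule _ (@full_closed V).

Lemma gen_closed V (P : V -> Prop) :
  submod_closed [pred v | `[< forall N : submodule V,
    (forall x, P x -> x \in N) -> v \in N >]].
Proof.
split=> [|c u v /asboolP Pu /asboolP Pv]; apply/asboolP => N PN.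
  exact: rpred0.
by rewrite rpredD ?rpredZ ?Pu ?Pv.
Qed.
Definition gen V (P : V -> Prop) := Submodule _ (@gen_closed V P).

Definition fg_sub V (N : submodule V) :=
  exists s : seq V, N =i gen (fun v => v \in s).

Definition fg V := fg_sub (full_sub V).

Definition scale_sub V (I : ideal R) (N : submodule V) : submodule V :=
  gen (fun v => exists x w, [/\ x \in I, w \in N & v = x *: w]).

Definition ideal_pow (I : ideal R) (k : nat) : ideal R :=
  iter k (scale_sub I) (full_sub R^o).

End Submodules.

Definition noetherian (R : comNzRingType) := forall I : ideal R, fg_sub I.

Section SubQuotients.
Variables (R : comNzRingType).
Implicit Types (V W : lmodType R).

Section Sub.
Variables (V : lmodType R) (N : submodule V).
Record subm := Subm { subm_val :> V; _ : subm_val \in N }.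
HB.instance Definition _ := [isSub for subm_val].
HB.instance Definition _ := [Choice of subm by <:].
HB.instance Definition _ := [SubChoice_isSubLmodule of subm by <:].
End Sub.

Section Quot.
Variables (V : lmodType R) (N : submodule V).
Definition quotm := Quotient.quot N.
HB.instance Definition _ := GRing.Zmodule.on quotm.
Definition qproj (v : V) : quotm := \pi v.
Definition qscale (c : R) (x : quotm) : quotm := qproj (c *: repr x).

Lemma qprojP (u v : V) : (qproj u == qproj v) = (u - v \in N).
Proof. by rewrite Quotient.idealrBE. Qed.

Lemma qproj_surj (x : quotm) : qproj (repr x) = x.
Proof. exact: reprK. Qed.

Lemma qproj_is_zmod : zmod_morphism qproj.
Proof. by move=> u v; rewrite /qproj !piE. Qed.

Lemma qscaleE c v : qscale c (qproj v) = qproj (c *: v).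
Proof.
by apply/eqP; rewrite qprojP -scalerBr rpredZ // -qprojP qproj_surj.
Qed.

Let qprojD u v : qproj (u + v) = qproj u + qproj v.
Proof. by rewrite /qproj !piE. Qed.

Fact qscaleA c d x : qscale c (qscale d x) = qscale (c * d) x.
Proof. by rewrite -[x]qproj_surj !qscaleE scalerA. Qed.
Fact qscale1 : left_id 1 qscale.
Proof. by move=> x; rewrite -[x]qproj_surj qscaleE scale1r. Qed.
Fact qscaleDr : right_distributive qscale +%R.
Proof.
by move=> c x y; rewrite -[x]qproj_surj -[y]qproj_surj -qprojD !qscaleE
  scalerDr qprojD.
Qed.
Fact qscaleDl x : {morph qscale^~ x : c d / c + d}.
Proof. by move=> c d; rewrite -[x]qproj_surj !qscaleE scalerDl qprojD. Qed.

HB.instance Definition _ := GRing.Zmodule_isLmodule.Build R quotm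
  qscaleA qscale1 qscaleDr qscaleDl.
HB.instance Definition _ := GRing.isZmodMorphism.Build V quotm qproj
  qproj_is_zmod.
HB.instance Definition _ := GRing.isScalable.Build R V quotm *:%R qproj
  (fun c v => esym (qscaleE c v)).
End Quot.

Section SubMap.
Variables (V W : lmodType R) (N : submodule V) (P : submodule W).
Variables (f : {linear V -> W}) (fNP : forall v, v \in N -> f v \in P).
Definition sub_map (v : subm N) : subm P := Subm (fNP (valP v)).
Fact sub_map_linear : linear sub_map.
Proof. by move=> c u v; apply: val_inj; rewrite /= !linearP. Qed.
HB.instance Definition _ :=
  GRing.isLinear.Build R (subm N) (subm P) *:%R sub_map sub_map_linear.
End SubMap.

Section QuotMap.
Variables (V W : lmodType R) (N : submodule V) (P : submodule W).
Variables (f : {linear V -> W}) (fNP : forall v, v \in N -> f v \in P).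
Definition quot_map of (forall v, v \in N -> f v \in P) :=
  fun x : quotm N => qproj P (f (repr x)).
Lemma quot_mapE v : quot_map fNP (qproj N v) = qproj P (f v).
Proof.
by apply/eqP; rewrite qprojP -linearB fNP // -qprojP qproj_surj.
Qed.
Fact quot_map_linear : linear (quot_map fNP).
Proof.
move=> c x y; rewrite -[x]qproj_surj -[y]qproj_surj -linearP !quot_mapE.
by rewrite !linearP.
Qed.
HB.instance Definition _ :=
  GRing.isLinear.Build R (quotm N) (quotm P) *:%R (quot_map fNP)
    quot_map_linear.
End QuotMap.

End SubQuotients.

Section Hom.
Variables (R : comNzRingType).
Implicit Types (V W X : lmodType R).

Lemma hom_closed V W : submod_closed [pred f : V -> W | `[< linear f >]].
Proof.
split=> [|c f g /asboolP lf /asboolP lg]; apply/asboolP => d u v.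
  by rewrite /= scaler0 addr0.
rewrite !(addrfctE, scalrfctE) lf lg !scalerDr !scalerA addrACA.
by rewrite [c * d]mulrC.
Qed.
Definition hom_sub V W := Submodule _ (@hom_closed V W).
Definition hom_mod V W : lmodType R := subm (hom_sub V W).

Fact pullback_proof V W X (f : {linear V -> W}) (h : hom_mod W X) :
  (subm_val h) \o f \in hom_sub V X.
Proof.
apply/asboolP => c u v; case: h => h /= /asboolP lh.
by rewrite linearP lh.
Qed.
Definition pullback V W X (f : {linear V -> W}) (h : hom_mod W X) : hom_mod V X :=
  Subm (pullback_proof f h).
Fact pullback_linear V W X (f : {linear V -> W}) :
  linear (@pullback V W X f).
Proof. by move=> c g h; apply: val_inj. Qed.
HB.instance Definition _ V W X (f : {linear V -> W}) :=
  GRing.isLinear.Build R (hom_mod W X) (hom_mod V X) *:%R (@pullback V W X f)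
    (pullback_linear f).

End Hom.

Section Complexes.
Variable R : comNzRingType.

Record cochain_complex := CochainComplex {
  cc_obj :> nat -> lmodType R;
  cc_d : forall i, {linear cc_obj i -> cc_obj i.+1};
  cc_dd : forall i (x : cc_obj i), cc_d i.+1 (cc_d i x) = 0
}.

Record cochain_map (C D : cochain_complex) := CochainMap {
  cm_map :> forall i, {linear C i -> D i};
  cm_comm : forall i (x : C i), cm_map i.+1 (cc_d C i x) = cc_d D i (cm_map i x)
}.

Definition cocycles (C : cochain_complex) i : submodule (C i) := ker (cc_d C i).

Definition coboundaries (C : cochain_complex) i : submodule (C i) :=
  match i with
  | 0 => zero_sub (C 0)
  | j.+1 => im (cc_d C j)
  end.

Definition boundary_sub (C : cochain_complex) i : submodule (subm (cocycles C i)) :=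
  preim_sub (\val : {linear subm (cocycles C i) -> C i}) (coboundaries C i).

Definition cohomology (C : cochain_complex) i : lmodType R :=
  quotm (boundary_sub C i).

Section Functoriality.
Variables (C D : cochain_complex) (f : cochain_map C D) (i : nat).

Fact cocycles_map x : x \in cocycles C i -> f i x \in cocycles D i.
Proof. by rewrite !inE -cm_comm => /eqP->; rewrite linear0. Qed.

Fact coboundaries_map x : x \in coboundaries C i -> f i x \in coboundaries D i.
Proof.
case: i x => [|j] x; first by rewrite !inE => /eqP->; rewrite linear0.
by move=> /asboolP[y <-]; apply/asboolP; exists (f j y); rewrite cm_comm.
Qed.

Fact boundary_sub_map x :
  x \in boundary_sub C i -> sub_map cocycles_map x \in boundary_sub D i.
Proof. exact: coboundaries_map. Qed.

Definition cohomology_map : {linear cohomology C i -> cohomology D i} :=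
  quot_map boundary_sub_map.
End Functoriality.

End Complexes.

(* The standard free resolution: F_i = R^(Omega^i M), where Omega V is the
   kernel of the canonical surjection R^(V) -> V and Omega^0 M = M.  It is
   functorial in M. *)
Section FreeResolution.
Variable R : comNzRingType.
Implicit Types (V W X M N : lmodType R).

Definition Free V : lmodType R := {freeg V / R}.

Section Lift.
Variables (V W : lmodType R) (f : V -> W).
Definition free_lift : Free V -> W := fglift f.
Fact free_lift_linear : linear free_lift.
Proof.
have lB : {morph free_lift : D E / D - E} := lift_is_additive f.
have l0 : free_lift 0 = 0 by rewrite -(subrr 0) lB subrr.
have lD : {morph free_lift : D E / D + E}.
  by move=> D E; rewrite -[E]opprK lB -[- - E]sub0r lB l0 sub0r.
have lS (s : seq V) (F : V -> Free V) :
    free_lift (\sum_(v <- s) F v) = \sum_(v <- s) free_lift (F v).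
  exact: big_morph.
have lU c v : free_lift << c *g v >> = c *: f v by exact: liftU.
have lE D : free_lift D = \sum_(v <- dom D) coeff v D *: f v.
  by rewrite -[D in LHS]freeg_sumE lS; apply: eq_bigr.
move=> c D E; rewrite lD lE; congr (_ + _).
rewrite -lE {1}[c *: D]/(fgscale c D) /fgscale lS lE scaler_sumr.
by apply: eq_bigr => v _; rewrite lU scalerA.
Qed.
HB.instance Definition _ :=
  GRing.isLinear.Build R (Free V) W *:%R free_lift free_lift_linear.
Lemma free_liftU c v : free_lift << c *g v >> = c *: f v.
Proof. exact: liftU. Qed.
End Lift.

Lemma free_ext V W (f g : {linear Free V -> W}) :
  (forall v, f << v >> = g << v >>) -> f =1 g.
Proof.
move=> fg D; rewrite -[D]freeg_sumE !linear_sum; apply: eq_bigr => v _.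
have -> : << coeff v D *g v >> = coeff v D *: (<< v >> : Free V).
  by apply/eqP/freeg_eqP => w; rewrite coeffZ !coeffU mul1r.
by rewrite !linearZ fg.
Qed.

Definition aug V : {linear Free V -> V} := free_lift (@id V).

Lemma aug_surj V (v : V) : exists D, aug V D = v.
Proof. by exists << v >>; rewrite /= free_liftU scale1r. Qed.

Definition free_map V W (f : {linear V -> W}) : {linear Free V -> Free W} :=
  free_lift (fun v => << f v >> : Free W).

Lemma aug_free_map V W (f : {linear V -> W}) D :
  aug W (free_map f D) = f (aug V D).
Proof.
apply: (free_ext (f := aug W \o free_map f) (g := f \o aug V)) => v.
by rewrite /= !free_liftU !scale1r free_liftU scale1r.
Qed.

Definition Omega V : lmodType R := subm (ker (aug V)).

Fact Omega_map_proof V W (f : {linear V -> W}) D :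
  D \in ker (aug V) -> free_map f D \in ker (aug W).
Proof. by rewrite !inE aug_free_map => /eqP->; rewrite linear0. Qed.
Definition Omega_map V W (f : {linear V -> W}) : {linear Omega V -> Omega W} :=
  sub_map (@Omega_map_proof V W f).

Definition syzygy M (i : nat) : lmodType R := iter i Omega M.

Fixpoint syzygy_map M N (f : {linear M -> N}) (i : nat) :
    {linear syzygy M i -> syzygy N i} :=
  match i with
  | 0 => f
  | j.+1 => Omega_map (syzygy_map f j)
  end.

Definition res M (i : nat) : lmodType R := Free (syzygy M i).

Definition res_d M (i : nat) : {linear res M i.+1 -> res M i} :=
  (\val : {linear Omega (syzygy M i) -> res M i}) \o aug (syzygy M i.+1).

Definition res_map M N (f : {linear M -> N}) i : {linear res M i -> res N i} :=
  free_map (syzygy_map f i).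

Lemma res_exact0 M (x : res M 0) :
  aug M x = 0 <-> exists y, res_d M 0 y = x.
Proof.
split=> [x0|[y <-]]; last exact/eqP/(valP (aug (syzygy M 1) y)).
have xk : x \in ker (aug M) by apply/eqP.
by have [y yx] := aug_surj (Subm xk : syzygy M 1); exists y; rewrite /= yx.
Qed.

Lemma res_exactS M i (x : res M i.+1) :
  res_d M i x = 0 <-> exists y, res_d M i.+1 y = x.
Proof.
split=> [x0|[y <-]]; last first.
  by have /eqP /= -> := valP (aug (syzygy M i.+2) y).
have xk : x \in ker (aug (syzygy M i.+1)) by apply/eqP/val_inj.
by have [y yx] := aug_surj (Subm xk : syzygy M i.+2); exists y; rewrite /= yx.
Qed.

Lemma res_map_comm M N (f : {linear M -> N}) i (x : res M i.+1) :
  res_d N i (res_map f i.+1 x) = res_map f i (res_d M i x).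
Proof. by rewrite /= aug_free_map. Qed.

End FreeResolution.

Section Ext.
Variable R : comNzRingType.
Implicit Types (M N X : lmodType R).

Fact hom_linear V X (h : hom_mod V X) : linear (subm_val h).
Proof. by case: h => h /= /asboolP. Qed.

Fact hom_dd M X i (h : hom_mod (res M i) X) :
  pullback (res_d M i.+1) (pullback (res_d M i) h) = 0.
Proof.
apply/val_inj/funext => x.
have dd0 : res_d M i (res_d M i.+1 x) = 0 by apply/res_exactS; exists x.
have h0 : subm_val h 0 = 0.
  by have := hom_linear h 1 0 0; rewrite !scale1r addr0 => /eqP;
     rewrite -subr_eq subrr => /eqP.
by move: dd0 => /= ->.
Qed.

(* For i = 0 the incoming differential is 0, so Ext^0 is the kernel of
   Hom(F_0, X) -> Hom(F_1, X); the augmentation M is not part of the complex. *)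
Definition hom_complex M X : cochain_complex R :=
  CochainComplex (@hom_dd M X).

Definition Ext (i : nat) M X : lmodType R := cohomology (hom_complex M X) i.

Fact hom_complex_map_comm M N X (f : {linear M -> N}) i
    (h : hom_complex N X i) :
  pullback (res_map f i.+1) (cc_d (hom_complex N X) i h) =
  cc_d (hom_complex M X) i (pullback (res_map f i) h).
Proof.
apply/val_inj/funext => x.
by have /= := congr1 (subm_val h) (res_map_comm f x).
Qed.

Definition hom_complex_map M N X (f : {linear M -> N}) :
    cochain_map (hom_complex N X) (hom_complex M X) :=
  @CochainMap R (hom_complex N X) (hom_complex M X)
    (fun i => pullback (res_map f i)) (@hom_complex_map_comm M N X f).

Definition Ext_map i M N X (f : {linear M -> N}) :
    {linear Ext i N X -> Ext i M X} :=
  cohomology_map (hom_complex_map X f) i.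

End Ext.

Section DirectLimit.
Variable R : comNzRingType.

Section Product.
Variable E : nat -> lmodType R.

Definition dprod := forall k, E k.
HB.instance Definition _ := Choice.copy dprod (forall k, E k).

Definition dprod_add (s t : dprod) : dprod := fun k => s k + t k.
Definition dprod_opp (s : dprod) : dprod := fun k => - s k.
Definition dprod_zero : dprod := fun=> 0.
Definition dprod_scale (c : R) (s : dprod) : dprod := fun k => c *: s k.

Fact dprod_addA : associative dprod_add.
Proof. by move=> s t u; apply: functional_extensionality_dep => k; exact: addrA. Qed.
Fact dprod_addC : commutative dprod_add.
Proof. by move=> s t; apply: functional_extensionality_dep => k; exact: addrC. Qed.
Fact dprod_add0 : left_id dprod_zero dprod_add.
Proof. by move=> s; apply: functional_extensionality_dep => k; exact: add0r. Qed.
Fact dprod_addN : left_inverse dprod_zero dprod_opp dprod_add.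
Proof. by move=> s; apply: functional_extensionality_dep => k; exact: addNr. Qed.
HB.instance Definition _ :=
  GRing.isZmodule.Build dprod dprod_addA dprod_addC dprod_add0 dprod_addN.

Fact dprod_scaleA c d s : dprod_scale c (dprod_scale d s) = dprod_scale (c * d) s.
Proof. by apply: functional_extensionality_dep => k; exact: scalerA. Qed.
Fact dprod_scale1 : left_id 1 dprod_scale.
Proof. by move=> s; apply: functional_extensionality_dep => k; exact: scale1r. Qed.
Fact dprod_scaleDr : right_distributive dprod_scale +%R.
Proof. by move=> c s t; apply: functional_extensionality_dep => k; exact: scalerDr. Qed.
Fact dprod_scaleDl s : {morph dprod_scale^~ s : c d / c + d}.
Proof. by move=> c d; apply: functional_extensionality_dep => k; exact: scalerDl. Qed.
HB.instance Definition _ := GRing.Zmodule_isLmodule.Build R dprod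
  dprod_scaleA dprod_scale1 dprod_scaleDr dprod_scaleDl.

Lemma dsum_closed :
  submod_closed [pred s : dprod | `[< exists K, forall k, (K <= k)%N -> s k = 0 >]].
Proof.
split=> [|c s t /asboolP[K sK] /asboolP[L tL]]; apply/asboolP.
  by exists 0%N.
exists (maxn K L) => k; rewrite geq_max => /andP[Kk Lk].
change (c *: s k + t k = 0).
by rewrite sK // tL // scaler0 addr0.
Qed.
Definition dsum_sub : submodule dprod := Submodule _ dsum_closed.
Definition dsum : lmodType R := subm dsum_sub.

Fact dsum_in_proof k (x : E k) : dfwith (fun j => 0 : E j) x \in dsum_sub.
Proof.
apply/asboolP; exists k.+1 => j kj; rewrite dfwith_out //.
by rewrite neq_ltn kj.
Qed.
Definition dsum_in k (x : E k) : dsum := Subm (dsum_in_proof x).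

End Product.

(* The direct limit of E 0 -> E 1 -> E 2 -> ... is the quotient of the direct
   sum of the E k by the submodule identifying each x in E k with its image in
   E (k+1). *)
Variables (E : nat -> lmodType R) (phi : forall k, {linear E k -> E k.+1}).

Definition dirlim_rel : submodule (dsum E) :=
  gen (fun s => exists k (x : E k), s = dsum_in x - dsum_in (phi k x)).

Definition dirlim : lmodType R := quotm dirlim_rel.

End DirectLimit.

Section LocalCohomology.
Variables (R : comNzRingType) (a : ideal R).
Implicit Types (M X : lmodType R).

(* The submodule a^k M of M. *)
Definition pow_sub M (k : nat) : submodule M :=
  scale_sub (ideal_pow a k) (full_sub M).

Fact pow_sub_le M k v : v \in pow_sub M k.+1 -> v \in pow_sub M k.
Proof.
move=> /asboolP; apply=> _ [x [w [xa wM ->]]]; apply/asboolP => N sN.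
apply: sN; exists x, w; split=> //.
by move: xa => /asboolP; apply=> _ [y [z [_ za ->]]]; apply: rpredZ.
Qed.

Definition quot_pow M (k : nat) : lmodType R := quotm (pow_sub M k).

Definition quot_pow_proj M (k : nat) :
    {linear quot_pow M k.+1 -> quot_pow M k} :=
  quot_map (f := idfun) (@pow_sub_le M k).

(* H^i_a(M, X), the limit of the Ext^i(M / a^k M, X) along the maps induced by
   the projections M / a^(k+1) M -> M / a^k M, and H^i_a(X) = H^i_a(R, X). *)
Definition glc (i : nat) M X : lmodType R :=
  dirlim (fun k => Ext_map i X (quot_pow_proj M k)).

Definition lc (i : nat) X : lmodType R := glc i R^o X.

End LocalCohomology.

Definition is_zero (R : comNzRingType) (V : lmodType R) := forall v : V, v = 0.

Definition isomorphic (R : comNzRingType) (V W : lmodType R) :=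
  exists f : {linear V -> W}, bijective f.

(* Main.v *)
Require Import Defs.
From HB Require Import structures.
From mathcomp Require Import all_boot all_order all_algebra.
From mathcomp Require Import zify.
From mathcomp Require Import boolp functions classical_sets freeg.

Set Implicit Arguments.
Unset Strict Implicit.
Unset Printing Implicit Defensive.

Import Order.TTheory GRing.Theory Num.Theory.
Local Open Scope ring_scope.

(** Why the theorem holds.  Let [X = X_0] be resolved by injective modules
   [I_0 -> I_1 -> ...], cut into exact sequences [0 -> X_q -> I_q -> X_(q+1) -> 0].
   Write [Gamma] for the [a]-torsion functor and put [Z_q = Gamma X_q],
   [Y_q = Gamma I_q], and let [B_(q+1)] be the image of [Y_q -> Z_(q+1)], with
   [B_0 = 0].  By dimension shifting, a class of [Ext^q(N, X)] is a homomorphism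
   [N -> X_q] modulo those that lift to [I_(q-1)] (Ext_of_hom_ker).  As [M] is
   finitely generated, [Hom(M, Gamma V)] is the limit of the [Hom(M / a^k M, V)];
   so in the limit [H^q_a(M, X)] is [Hom(M, Z_q)] modulo the image of
   [Hom(M, Y_(q-1))] (glc_of_hom_exists).  For [M = R] this says that
   [0 -> B_q -> Z_q -> H^q_a(X) -> 0] is exact; so is
   [0 -> Z_q -> Y_q -> B_(q+1) -> 0], and [Y_q] is injective because [R] is
   Noetherian (Gamma_injective).

   The long exact sequences of [Ext(M, _)] for these two families form the exact
   couple of the spectral sequence
   [Ext^p(M, H^q_a(X)) => H^(p+q)_a(M, X)], with
   [D^(p,q) = Ext^p(M, Z_q)] for [p > 0] and [D^(0,q) = H^q_a(M, X)].  Rather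
   than a convergence theorem, only the vanishing of the terms named in the
   hypotheses is used.  On the antidiagonal [p + q = m + n], hypotheses h1
   and h3 make [D^(p+1,q-1) -> D^(p,q)] an isomorphism for all [q > n]
   (glc_cocycle, Ext_cocycle_step), so that [H^(m+n)_a(M, X)] is [D^(m,n)].
   The neighbours of [Ext^m(M, H^n_a(X))] in the sequence through [D^(m,n)] are
   [Ext^m(M, B_n)] and [Ext^(m+1)(M, B_n)]; going down to [B_0 = 0], hypotheses
   h1 and h2 kill both (Ext_boundary_zero), which gives the isomorphism
   (Ext_cocycle_cohomology).  When [m = 0] the two steps are taken together
   (glc_cohomology). *)

(** * Linear relations and Baer's criterion *)

Section LinearRelations.
Variables (R : comNzRingType) (V W : lmodType R).
Implicit Type G : V -> W -> Prop.

Definition linear_rel G :=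
  G 0 0 /\ forall c v w v' w', G v w -> G v' w' -> G (c *: v + v') (c *: w + w').

Definition functional_rel G := forall w, G 0 w -> w = 0.

Lemma linear_relB G v w v' w' :
  linear_rel G -> G v w -> G v' w' -> G (v - v') (w - w').
Proof.
move=> [_ linG] Gv Gv'; have := linG (-1) _ _ _ _ Gv' Gv.
by rewrite !scaleN1r ![- _ + _]addrC.
Qed.

Lemma linear_relZ G c v w : linear_rel G -> G v w -> G (c *: v) (c *: w).
Proof. by move=> [G0 linG] /(linG c) /(_ G0); rewrite !addr0. Qed.

Lemma functional_relP G v w w' :
  linear_rel G -> functional_rel G -> G v w -> G v w' -> w = w'.
Proof.
move=> linG funG Gw Gw'; apply/eqP; rewrite -subr_eq0; apply/eqP/funG.
by have := linear_relB linG Gw Gw'; rewrite subrr.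
Qed.

(** Maps defined by choosing representatives are built from their graph, where
    independence of the choices and linearity are checked without naming a
    choice. *)
Lemma graph_linear G : linear_rel G -> functional_rel G ->
  (forall v, exists w, G v w) ->
  exists f : {linear V -> W}, forall v w, G v w <-> f v = w.
Proof.
move=> linG funG totG; have [f Gf] := choice totG.
have linf : linear f.
  move=> c u v; apply: (functional_relP linG funG (Gf _)).
  exact: linG.2.
pose F : {linear V -> W} := HB.pack f (GRing.isLinear.Build R V W *:%R f linf).
exists F => v w; split=> [Gw|<-]; last exact: Gf.
exact: (functional_relP linG funG (Gf v)).
Qed.

End LinearRelations.

Section Injective.
Variable R : comNzRingType.
Implicit Types V W : lmodType R.

(** A map defined on a submodule is encoded by its graph [G], so that this is the
    extension property along all inclusions. *)
Definition injective_module W := forall V (G : V -> W -> Prop),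
  linear_rel G -> functional_rel G ->
  exists f : {linear V -> W}, forall v w, G v w -> f v = w.

Definition baer_module W := forall G : R^o -> W -> Prop,
  linear_rel G -> functional_rel G -> exists y, forall r w, G r w -> r *: y = w.

(** Zorn's lemma applies since the union of a chain of functional linear
    relations is one; the empty chain is bounded by [G] itself. *)
Lemma maximal_linear_rel V W (G : V -> W -> Prop) :
  linear_rel G -> functional_rel G ->
  exists H : V -> W -> Prop, [/\ linear_rel H, functional_rel H,
    forall v w, G v w -> H v w &
    forall K : V -> W -> Prop, linear_rel K -> functional_rel K ->
      (forall v w, H v w -> K v w) -> forall v w, K v w -> H v w].
Proof.
move=> linG funG.
pose T := {H : V -> W -> Prop |
  [/\ linear_rel H, functional_rel H & forall v w, G v w -> H v w]}.
pose le (s t : T) := `[< forall v w, sval s v w -> sval t v w >].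
have G0 : [/\ linear_rel G, functional_rel G & forall v w, G v w -> G v w] by [].
have [||A totA|[H [linH funH GH]] maxH] := @ZL_preorder T (exist _ G G0) le.
- by move=> t; apply/asboolP.
- by move=> r s t /asboolP rs /asboolP st; apply/asboolP => v w /rs /st.
- have [[s0 As0]|noA] := pselect (exists s, A s); last first.
    by exists (exist _ G G0) => s As; case: noA; exists s.
  pose U v w := exists2 s, A s & sval s v w.
  have UP : [/\ linear_rel U, functional_rel U & forall v w, G v w -> U v w].
    split; first split.
    - by exists s0 => //; case: (svalP s0) => -[].
    - move=> c v w v' w' [s As sv] [t At tv].
      have [/asboolP/(_ _ _ sv) tv2|/asboolP/(_ _ _ tv) sv2] := totA _ _ As At.
        by exists t => //; case: (svalP t) => -[_ lint] _ _; apply: lint.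
      by exists s => //; case: (svalP s) => -[_ lins] _ _; apply: lins.
    - by move=> w [s _]; case: (svalP s) => _ funs _ /funs.
    - by move=> v w Gvw; exists s0 => //; case: (svalP s0) => _ _; apply.
  by exists (exist _ U UP) => s As; apply/asboolP => v w svw; exists s.
exists H; split=> // K linK funK HK v w Kvw.
have KP : [/\ linear_rel K, functional_rel K & forall v w, G v w -> K v w].
  by split=> // v' w' /GH /HK.
have /asboolP := maxH (exist _ K KP) (asboolT HK); apply.
exact: Kvw.
Qed.

(** Baer's criterion: a maximal linear extension is total, because its domain
   can be enlarged by any element [v] once the partial map [r |-> r *: v] on
   the conductor ideal of [v] has been extended to the whole ring. *)
Lemma baer_injective W : baer_module W -> injective_module W.
Proof.
move=> baerW V G linG funG.
have [H [linH funH GH maxH]] := maximal_linear_rel linG funG.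
suff totH v : exists w, H v w.
  by have [f Hf] := graph_linear linH funH totH; exists f => v w /GH /Hf.
have [|w /= vw|y yP] := baerW (fun r w => H (r *: v) w).
- split=> [|c r w r' w' rw r'w']; first by rewrite scale0r; case: linH.
  by rewrite scalerDl -scalerA; apply: linH.2.
- by apply: funH; rewrite -(scale0r v).
(* The relation [H] enlarged by the pair [(v, y)]. *)
pose K u w := exists c u' w', [/\ H u' w', u = u' + c *: v & w = w' + c *: y].
exists y; apply: (maxH K).
- split; first by exists 0, 0, 0; rewrite !scale0r !addr0; split=> //; case: linH.
  move=> c _ _ _ _ [d [u [w [Hu -> ->]]]] [d' [u' [w' [Hu' -> ->]]]].
  exists (c * d + d'), (c *: u + u'), (c *: w + w'); split; first exact: linH.2.
    by rewrite scalerDr scalerDl scalerA addrACA.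
  by rewrite scalerDr scalerDl scalerA addrACA.
- move=> z [c [u [w [Huw /esym/eqP + ->]]]]; rewrite addr_eq0 => /eqP uE.
  have : H (- c *: v) w by rewrite scaleNr -uE.
  by move=> /yP <-; rewrite scaleNr addNr.
- by move=> u w Huw; exists 0, u, w; rewrite !scale0r !addr0.
by exists 1, 0, 0; rewrite !scale1r !add0r; split=> //; case: linH.
Qed.

End Injective.
(** * The injective abelian group of rationals modulo integers *)

Section RationalsModuloIntegers.

Fact integers_closed : submod_closed (Num.int : {pred zmodule rat}).
Proof.
split=> [|c u v uZ vZ]; first exact: rpred0.
by rewrite rpredD // scalezrE rpredMz.
Qed.
Definition integers : submodule (zmodule rat) := Submodule _ integers_closed.
Definition QmodZ : lmodType int := quotm integers.

Lemma QmodZ_eq0 (q : rat) : (qproj integers q == 0) = (q \in Num.int).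
Proof. by rewrite -(linear0 (qproj integers)) qprojP subr0. Qed.

Lemma qproj_scale (n : int) (q : rat) :
  n *: qproj integers q = qproj integers (n%:~R * q).
Proof. by rewrite -linearZ /= scalezrE mulrzl. Qed.

(** Ideals of the integers are principal, so Baer's criterion reduces to
    divisibility. *)
Lemma QmodZ_injective : injective_module QmodZ.
Proof.
apply: baer_injective => G linG funG.
have [[n [w [n0 Gnw]]]|noG] :=
    pselect (exists (n : nat) w, (0 < n)%N /\ G n%:Z w); last first.
  exists 0 => r w Grw; rewrite scaler0; apply/esym/funG.
  suff <- : r = 0 by [].
  apply/eqP; apply/negP => /negP r0; apply: noG.
  exists `|r|%N; have [r_ge0|r_lt0] := leP 0 r.
    by exists w; rewrite absz_gt0 gez0_abs.
  exists (- w); rewrite absz_gt0 ltz0_abs //; split=> //.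
  by rewrite -[- r]sub0r -[- w]sub0r; apply: linear_relB => //; case: linG.
pose P d := (0 < d)%N && `[< exists w, G d%:Z w >].
have exP : exists d, P d by exists n; rewrite /P n0; apply/asboolP; exists w.
case: (ex_minnP exP) => d /andP[d0 /asboolP[wd Gd]] mind.
exists (qproj integers ((repr wd : rat) / d%:R)) => r w' Gr.
have dwd : d%:Z *: qproj integers ((repr wd : rat) / d%:R) = wd.
  rewrite qproj_scale mulrC divfK ?qproj_surj //.
  by rewrite pnatr_eq0 -lt0n.
have rE : r = (r %/ d)%Z *: (d%:Z : int^o).
  have := linear_relB linG Gr (linear_relZ (r %/ d)%Z linG Gd).
  rewrite {1}(divz_eq r d) /= addrAC subrr add0r => Grem.
  have [k kE] : exists k : nat, (r %% d)%Z = k.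
    by exists `|(r %% d)%Z|%N; rewrite gez0_abs // modz_ge0 // eqz_nat -lt0n.
  rewrite kE in Grem; have [k0|k0] := posnP k.
    by rewrite [LHS](divz_eq r d) kE k0 addr0.
  have : (d <= k)%N.
    by apply: mind; rewrite /P k0; apply/asboolP; eexists; exact: Grem.
  by rewrite leqNgt -ltz_nat -kE ltz_pmod // ltz_nat.
rewrite rE -scalerA dwd.
by apply: (functional_relP linG funG _ Gr); rewrite {1}rE; apply: linear_relZ.
Qed.

(** The cyclic group generated by [v] maps to [Q/Z] by [v |-> 1/d], where [d > 1]
    divides every integer killing [v], and this map extends to [V]. *)
Lemma QmodZ_separates (V : lmodType int) (v : V) :
  v != 0 -> exists f : {linear V -> QmodZ}, f v != 0.
Proof.
move=> v0.
have [d [d1 dP]] : exists d : nat, (1 < d)%N /\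
    forall n : int, n *: v = 0 -> (d %| n)%Z.
  pose P d := (0 < d)%N && (d%:Z *: v == 0).
  have [exP|noP] := pselect (exists d, P d); last first.
    exists 2; split=> // n nv; have [->|n0] := eqVneq n 0; first exact: dvdz0.
    case: noP; exists `|n|%N; rewrite /P absz_gt0 n0 /=.
    have [n_ge0|n_lt0] := leP 0 n; first by rewrite gez0_abs // nv.
    by rewrite ltz0_abs // scaleNr nv oppr0.
  case: (ex_minnP exP) => d /andP[d0 /eqP dv] mind; exists d; split.
    case: d d0 dv mind => [|[|d]] // _ /=; rewrite scale1r => /eqP.
    by rewrite (negPf v0).
  move=> n nv; apply/dvdz_mod0P.
  have [k kE] : exists k : nat, (n %% d)%Z = k.
    by exists `|(n %% d)%Z|%N; rewrite gez0_abs // modz_ge0 // eqz_nat -lt0n.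
  have [k0|k0] := posnP k; first by rewrite kE k0.
  have : (d <= k)%N.
    apply: mind; rewrite /P k0 -kE; apply/eqP.
    move: nv; rewrite {1}(divz_eq n d) scalerDl -scalerA dv scaler0 add0r.
    by [].
  by rewrite leqNgt -ltz_nat -kE ltz_pmod // ltz_nat.
pose y := qproj integers (d%:R^-1 : rat).
have [||f fP] := @QmodZ_injective V
    (fun u w => exists n : int, u = n *: v /\ w = n *: y).
- split; first by exists 0; rewrite !scale0r.
  move=> c _ _ _ _ [n [-> ->]] [k [-> ->]]; exists (c * n + k).
  by rewrite !scalerDl !scalerA.
- move=> w [n [/esym/dP/dvdzP[k ->] ->]]; apply/eqP.
  rewrite qproj_scale QmodZ_eq0 intrM -mulrA -pmulrn divff ?mulr1 ?intr_int //.
  by rewrite pnatr_eq0 -lt0n (ltn_trans _ d1).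
exists f; rewrite (fP v y); last by exists 1; rewrite !scale1r.
rewrite QmodZ_eq0; apply/negP => /intrP[k kE].
have d0 : (d%:R : rat) != 0 by rewrite pnatr_eq0 -lt0n (ltn_trans _ d1).
have : k%:~R * d%:Z%:~R = 1 :> rat by rewrite -kE -pmulrn mulVf.
rewrite -intrM => /eqP; rewrite (eqr_int _ _ 1) => /eqP kd1.
have : (d%:Z %| 1)%Z by apply/dvdzP; exists k.
by rewrite dvdzE dvdn1 eqn_leq leqNgt d1.
Qed.

End RationalsModuloIntegers.

(** * Enough injective modules *)

Section Coinduction.
Variables (R : comNzRingType) (J : Type) (D : lmodType int).

Definition additive_families : {pred J -> R -> D} :=
  [pred F : J -> R -> D | `[< forall j, zmod_morphism (F j) >]].

Fact additive_families_closed : zmod_closed additive_families.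
Proof.
split=> [|F G /asboolP Fadd /asboolP Gadd]; apply/asboolP => j r s.
  by rewrite /= subr0.
rewrite -[LHS]/(F j (r - s) - G j (r - s)).
rewrite -[RHS]/((F j r - G j r) - (F j s - G j s)).
by rewrite Fadd Gadd !opprD !opprK addrACA.
Qed.
HB.instance Definition _ :=
  GRing.isZmodClosed.Build (J -> R -> D) additive_families
    additive_families_closed.

(** The [J]-th power of the module coinduced from [D].  Scalars act on the
    argument, as for [Hom_Z(R, D)], and not on the values: [D] is only an abelian
    group. *)
Record coinduced := Coinduced {
  coinduced_val :> J -> R -> D;
  _ : coinduced_val \in additive_families
}.
HB.instance Definition _ := [isSub for coinduced_val].
HB.instance Definition _ := [Choice of coinduced by <:].
HB.instance Definition _ := [SubChoice_isSubZmodule of coinduced by <:].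

Lemma coinducedB (F : coinduced) j r s : F j (r - s) = F j r - F j s.
Proof. by case: F => F /= /asboolP; apply. Qed.

Lemma coinduced0 (F : coinduced) j : F j 0 = 0.
Proof. by rewrite -(subrr 0) coinducedB subrr. Qed.

Lemma coinducedD (F : coinduced) j r s : F j (r + s) = F j r + F j s.
Proof.
by rewrite -[s in LHS]opprK coinducedB -[- s]sub0r coinducedB coinduced0 sub0r opprK.
Qed.

Lemma coinduced_eq (F G : coinduced) : (forall j r, F j r = G j r) -> F = G.
Proof. by move=> FG; apply/val_inj/funext => j; apply/funext => r; apply: FG. Qed.

Fact coinduced_scale_proof c (F : coinduced) :
  (fun j r => F j (r * c)) \in additive_families.
Proof. by apply/asboolP => j r s; rewrite mulrBl coinducedB. Qed.
Definition coinduced_scale c F := Coinduced (coinduced_scale_proof c F).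

Fact coinduced_scaleA c d F :
  coinduced_scale c (coinduced_scale d F) = coinduced_scale (c * d) F.
Proof. by apply: coinduced_eq => j r /=; rewrite mulrA. Qed.
Fact coinduced_scale1 : left_id 1 coinduced_scale.
Proof. by move=> F; apply: coinduced_eq => j r /=; rewrite mulr1. Qed.
Fact coinduced_scaleDr : right_distributive coinduced_scale +%R.
Proof. by move=> c F G; apply: coinduced_eq. Qed.
Fact coinduced_scaleDl F : {morph coinduced_scale^~ F : c d / c + d}.
Proof.
by move=> c d; apply: coinduced_eq => j r; rewrite /= mulrDr coinducedD.
Qed.
HB.instance Definition _ := GRing.Zmodule_isLmodule.Build R coinduced
  coinduced_scaleA coinduced_scale1 coinduced_scaleDr coinduced_scaleDl.

Lemma coinducedMz (F : coinduced) (n : int) j r : (F *~ n) j r = n *: F j r.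
Proof.
have evB : zmod_morphism (fun F : coinduced => F j r) by [].
pose ev : {additive coinduced -> D} :=
  HB.pack (fun F : coinduced => F j r) (GRing.isZmodMorphism.Build _ _ _ evB).
by rewrite -[LHS]/(ev (F *~ n)) raddfMz -scaler_int intz.
Qed.

(** Coinduction is right adjoint to restriction of scalars: a linear map to
    [coinduced] amounts to one additive map to [D] per index, namely its
    composite with the evaluation at [1], and additive maps to [D] extend. *)
Lemma coinduced_injective :
  injective_module D -> injective_module (coinduced : lmodType R).
Proof.
move=> injD V G linG funG.
have extD (j : J) : exists f : {linear zmodule V -> D},
    forall v w, G v w -> f v = (w : coinduced) j 1.
  have [||f fP] := injD (zmodule V) (fun v d => exists2 w, G v w & w j 1 = d).
  - split; first by exists 0 => //; case: linG.
    move=> n v _ v' _ [w Gw <-] [w' Gw' <-]; exists (w *~ n + w').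
      rewrite scalezrE -!scaler_int; exact: linG.2.
    by rewrite -coinducedMz.
  - by move=> _ [w /funG -> <-].
  by exists f => v w Gw; apply: fP; exists w.
have [f fP] := choice extD.
have gP (v : V) : (fun j (r : R) => f j (r *: v)) \in additive_families.
  apply/asboolP => j r s; rewrite scalerBl.
  exact: (raddfB (f j) (r *: v) (s *: v)).
have ling : linear (fun v : V => Coinduced (gP v) : coinduced).
  move=> c u v; apply: coinduced_eq => j r.
  rewrite /= scalerDr scalerA.
  exact: (raddfD (f j) ((r * c) *: u) (r *: v)).
pose g : {linear V -> coinduced} := HB.pack (fun v : V => Coinduced (gP v))
  (GRing.isLinear.Build R V coinduced *:%R _ ling).
exists g => v w Gw; apply: coinduced_eq => j r /=.
by rewrite (fP j _ (r *: w)) ?[LHS]/(w j (1 * r)) ?mul1r //; apply: linear_relZ.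
Qed.

End Coinduction.

Section EnoughInjectives.
Variables (R : comNzRingType) (V : lmodType R).

(** One coordinate per character of [V]: enough characters exist for [V] to
    embed by [v |-> (j, r) |-> j (r v)]. *)
Definition cofree : lmodType R :=
  coinduced R {linear zmodule V -> QmodZ} QmodZ.

Lemma cofree_injective : injective_module cofree.
Proof. exact/coinduced_injective/QmodZ_injective. Qed.

Fact to_cofree_proof (v : V) :
  (fun (j : {linear zmodule V -> QmodZ}) (r : R) => j (r *: v))
    \in @additive_families R _ QmodZ.
Proof.
apply/asboolP => j r s; rewrite scalerBl.
exact: (raddfB j (r *: v) (s *: v)).
Qed.
Definition to_cofree (v : V) : cofree := Coinduced (to_cofree_proof v).

Fact to_cofree_linear : linear to_cofree.
Proof.
move=> c u v; apply: coinduced_eq => j r.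
rewrite /= scalerDr scalerA.
exact: (raddfD j ((r * c) *: u) (r *: v)).
Qed.
HB.instance Definition _ :=
  GRing.isLinear.Build R V cofree *:%R to_cofree to_cofree_linear.

Lemma to_cofree_inj v : to_cofree v = 0 -> v = 0.
Proof.
move=> v0; apply/eqP; apply: contraT => /(@QmodZ_separates (zmodule V))[f].
have := congr1 (fun F : coinduced R _ QmodZ => F f 1) v0.
by rewrite /= scale1r => ->; rewrite eqxx.
Qed.

End EnoughInjectives.
Arguments to_cofree {R} V v.
(** * Noetherian rings: chains and powers of ideals *)

Section Noetherian.
Variable R : comNzRingType.
Implicit Types (V W : lmodType R) (I K L : ideal R).

Lemma gen_min V (P : V -> Prop) (N : submodule V) :
  (forall v, P v -> v \in N) -> {subset gen P <= N}.
Proof. by move=> PN v /asboolP; apply. Qed.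

Lemma sub_gen V (P : V -> Prop) v : P v -> v \in gen P.
Proof. by move=> Pv; apply/asboolP => N; apply. Qed.

(** The finitely many generators all appear at some stage. *)
Lemma fg_sub_exhaust V (N : submodule V) (T : nat -> submodule V) :
    fg_sub N -> (forall k, {subset T k <= T k.+1}) ->
    (forall v, v \in N -> exists k, v \in T k) ->
  exists k, {subset N <= T k}.
Proof.
move=> [s Ns] T_S NT.
have T_le k l : (k <= l)%N -> {subset T k <= T l}.
  move=> /subnK <-; elim: (l - k)%N => // d IH v /IH; exact: T_S.
have [k sT] : exists k, forall v, v \in s -> v \in T k.
  have : forall v, v \in s -> exists k, v \in T k.
    by move=> v vs; apply: NT; rewrite Ns; apply: sub_gen.
  elim: s {Ns} => [|v s IH] sT; first by exists 0%N.
  have [k vk] := sT v (mem_head _ _).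
  have [|l sl] := IH; first by move=> w ws; apply: sT; rewrite inE ws orbT.
  exists (maxn k l) => w; rewrite inE => /predU1P[->|/sl].
    by apply: T_le vk; rewrite leq_maxl.
  by apply: T_le; rewrite leq_maxr.
by exists k => v; rewrite Ns; apply: gen_min.
Qed.

Section Union.
Variables (V : lmodType R) (T : nat -> submodule V).
Hypothesis T_S : forall k, {subset T k <= T k.+1}.

Fact union_closed : submod_closed [pred v | `[< exists k, v \in T k >]].
Proof.
have T_le k l : (k <= l)%N -> {subset T k <= T l}.
  by move=> /subnK <-; elim: (l - k)%N => // d IH v /IH; exact: T_S.
split=> [|c u v /asboolP[k uk] /asboolP[l vl]]; apply/asboolP.
  by exists 0%N; rewrite rpred0.
exists (maxn k l); rewrite rpredD ?rpredZ //.
  by apply: T_le uk; rewrite leq_maxl.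
by apply: T_le vl; rewrite leq_maxr.
Qed.
Definition union_sub := Submodule _ union_closed.
End Union.

Hypothesis noethR : noetherian R.

Lemma ascending_chain (I : nat -> ideal R) :
  (forall k, {subset I k <= I k.+1}) ->
  exists n, forall k, {subset I k <= I n}.
Proof.
move=> I_S.
have [|n nP] := fg_sub_exhaust (noethR (union_sub I_S)) I_S.
  by move=> v /asboolP.
by exists n => k v vk; apply: nP; apply/asboolP; exists k.
Qed.

(** Otherwise strictly larger ideals could be chosen again and again, against the
    ascending chain condition. *)
Lemma maximal_ideal_exists (P : ideal R -> Prop) I : P I ->
  exists2 K, P K & forall L, P L -> {subset K <= L} -> {subset L <= K}.
Proof.
move=> PI; apply: contrapT => noK.
pose T := {K : ideal R | P K}.
have step (K : T) : exists L : T, {subset sval K <= sval L} /\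
    ~ {subset sval L <= sval K}.
  apply: contrapT => noL.
  case: noK; exists (sval K); first exact: svalP.
  move=> L PL KL; apply: contrapT => nLK.
  by case: noL; exists (exist _ L PL).
have [next nextP] := choice step.
pose C k := iter k next (exist _ I PI).
have [|n nP] := @ascending_chain (fun k => sval (C k)).
  by move=> k; case: (nextP (C k)).
by case: (nextP (C n)) => _; case; apply: (nP n.+1).
Qed.

Lemma idealMl K (r u : R) : u \in K -> r * u \in K.
Proof. exact: rpredZ. Qed.

Fact colon_closed K (x : R) : submod_closed [pred r : R^o | r * x \in K].
Proof.
split=> [|c r s]; rewrite !inE ?mul0r ?rpred0 // => rK sK.
by rewrite mulrDl -scalerAl; apply: rpredD => //; apply: rpredZ.
Qed.
Definition colon K x : ideal R := Submodule _ (@colon_closed K x).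

Fact adjoin_closed K (x : R) :
  submod_closed [pred y : R^o | `[< exists u r : R, u \in K /\ y = u + r * x >]].
Proof.
split=> [|c _ _ /asboolP[u [r [uK ->]]] /asboolP[v [s [vK ->]]]]; apply/asboolP.
  by exists 0, 0; split; [exact: rpred0 | rewrite mul0r addr0].
exists (c *: (u : R^o) + v), (c * r + s); split.
  by apply: rpredD => //; apply: rpredZ.
by rewrite scalerDr mulrDl addrACA -mulrA.
Qed.
Definition adjoin K x : ideal R := Submodule _ (@adjoin_closed K x).

Lemma sub_adjoin K x : {subset K <= adjoin K x}.
Proof. by move=> u uK; apply/asboolP; exists u, 0; rewrite mul0r addr0. Qed.

Lemma mem_adjoin K x : x \in adjoin K x.
Proof. by apply/asboolP; exists 0, 1; split; [exact: rpred0 | rewrite mul1r add0r]. Qed.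

Lemma ideal_powS_mul (a : ideal R) k (x w : R) :
  x \in a -> w \in ideal_pow a k -> x * w \in ideal_pow a k.+1.
Proof. by move=> xa wk; apply: sub_gen; exists x, w. Qed.

Lemma ideal_pow_expr (a : ideal R) (x : R) k : x \in a -> x ^+ k \in ideal_pow a k.
Proof. by move=> xa; elim: k => // k IH; rewrite exprS ideal_powS_mul. Qed.

Lemma ideal_pow_S (a : ideal R) k : {subset ideal_pow a k.+1 <= ideal_pow a k}.
Proof.
by apply: gen_min => _ [x [w [_ wk ->]]]; apply: rpredZ.
Qed.

(** One half of [a^(k+l) = a^k a^l], phrased with a test ideal [K] so that the
    induction on [k] can replace [K] by [(K : x)]. *)
Lemma ideal_pow_addn (a : ideal R) k l K :
  (forall u v : R, u \in ideal_pow a k -> v \in ideal_pow a l -> u * v \in K) ->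
  {subset ideal_pow a (k + l) <= K}.
Proof.
elim: k K => [|k IH] K uvK.
  by move=> v vl; rewrite -[v]mul1r uvK.
apply: gen_min => _ [x [w [xa wkl ->]]].
have /(_ w wkl) : {subset ideal_pow a (k + l) <= colon K x}.
  apply: IH => u v uk vl; rewrite inE mulrC mulrA uvK //; exact: ideal_powS_mul.
by rewrite inE mulrC.
Qed.

Definition nilpotent_mod (a K : ideal R) := exists N, {subset ideal_pow a N <= K}.

(** Induction on [n]: the ideal [(K : x)] contains [x^(n-1)], hence some [a^k],
    and [K + (x)] contains some [a^l]; then [a^(k+l)] is contained in
    [K (K : x) + x (K : x)], hence in [K]. *)
Lemma nilpotent_mod_adjoin (a : ideal R) (x : R) n K : x ^+ n \in K ->
  (forall L, {subset K <= L} -> x \in L -> nilpotent_mod a L) ->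
  nilpotent_mod a K.
Proof.
elim: n K => [|n IH] K xK nilL.
  by exists 0%N => r _; rewrite -[r]mulr1; apply: idealMl.
have KC : {subset K <= colon K x}.
  by move=> u uK; rewrite inE mulrC; apply: idealMl.
have [|L KL xL|k kP] := IH (colon K x).
- by rewrite inE -exprSr.
- by apply: nilL => // u /KC /KL.
have [l lP] := nilL _ (@sub_adjoin K x) (mem_adjoin K x).
exists (k + l)%N; apply: ideal_pow_addn => u v /kP uC /lP /asboolP.
move=> [w [r [wK ->]]]; rewrite mulrDr; apply: rpredD; first exact: idealMl.
by rewrite mulrCA; apply: idealMl.
Qed.

(** The generators of [a] are adjoined to [K] one at a time; once all of them are
    in, the ideal contains [a] itself. *)
Lemma nilpotent_modP (a K : ideal R) :
  (forall x : R, x \in a -> exists n, x ^+ n \in K) -> nilpotent_mod a K.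
Proof.
have [s aE] := noethR a => powK.
have {}powK (x : R) : x \in s -> exists n, x ^+ n \in K.
  by move=> xs; apply: powK; rewrite aE; apply: sub_gen.
have nilL L : {subset K <= L} -> {subset s <= L} -> nilpotent_mod a L.
  move=> _ sL; exists 1%N; apply: gen_min => _ [x [w [xa _ ->]]].
  rewrite -[_ *: _]/(x * w) mulrC; apply: idealMl; move: xa; rewrite aE.
  exact: gen_min.
elim: s K {aE} powK nilL => [|x s IH] K powK nilL; first exact: nilL.
have [n xK] := powK x (mem_head _ _).
apply: nilpotent_mod_adjoin xK _ => L KL xL.
apply: IH => [y ys|L' LL' sL'].
  have [|k /KL ?] := powK y; last by exists k.
  by rewrite inE ys orbT.
apply: nilL => [u /KL /LL' //|y]; rewrite inE => /predU1P[->|/sL' //].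
exact: LL'.
Qed.

End Noetherian.
(** * The torsion functor *)

Section Torsion.
Variables (R : comNzRingType) (a : ideal R).
Implicit Types V W : lmodType R.

Definition killed_by_pow V k (v : V) := forall r : R, r \in ideal_pow a k -> r *: v = 0.

Lemma killed_by_pow_le V k l (v : V) :
  (k <= l)%N -> killed_by_pow k v -> killed_by_pow l v.
Proof.
move=> /subnK <- kv; elim: (l - k)%N => // d IH r rd.
by apply: IH; apply: ideal_pow_S.
Qed.

Lemma killed_by_powP V k c (u v : V) :
  killed_by_pow k u -> killed_by_pow k v -> killed_by_pow k (c *: u + v).
Proof.
move=> ku kv r rk; rewrite scalerDr scalerA mulrC -scalerA ku // kv //.
by rewrite scaler0 addr0.
Qed.

Lemma killed_by_pow0 V k : killed_by_pow k (0 : V).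
Proof. by move=> r _; rewrite scaler0. Qed.

Fact torsion_closed V :
  submod_closed [pred v : V | `[< exists k, killed_by_pow k v >]].
Proof.
split=> [|c u v /asboolP[k ku] /asboolP[l lv]]; apply/asboolP.
  by exists 0%N; apply: killed_by_pow0.
exists (maxn k l); apply: killed_by_powP.
  by apply: killed_by_pow_le ku; rewrite leq_maxl.
by apply: killed_by_pow_le lv; rewrite leq_maxr.
Qed.
Definition torsion V : submodule V := Submodule _ (@torsion_closed V).

Definition Gamma V : lmodType R := subm (torsion V).

Lemma Gamma_val0 V (z : Gamma V) : (val z : V) = 0 -> z = 0.
Proof. by move=> z0; apply: val_inj. Qed.

Lemma torsion_map V W (f : {linear V -> W}) v :
  v \in torsion V -> f v \in torsion W.
Proof.
move=> /asboolP[k kv]; apply/asboolP; exists k => r rk.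
by rewrite -linearZ kv // linear0.
Qed.

Definition Gamma_map V W (f : {linear V -> W}) : {linear Gamma V -> Gamma W} :=
  Defs.sub_map (@torsion_map V W f).

(** The elements of [V] related to torsion of exponent [k] form a submodule that
    grows with [k], so a single [k] serves all of the generators of [N].  The map
    is given by a relation because one of the uses is for a map defined on an
    ideal only. *)
Lemma torsion_bounded V W (N : submodule V) (G : V -> Gamma W -> Prop) :
    fg_sub N -> linear_rel G -> functional_rel G ->
    (forall v, v \in N -> exists z, G v z) ->
  exists k, forall v z, v \in N -> G v z -> killed_by_pow k (val z).
Proof.
move=> fgN linG funG GN.
have T_closed k :
    submod_closed [pred v | `[< exists2 z, G v z & killed_by_pow k (val z) >]].
  split=> [|c u v /asboolP[x Gx kx] /asboolP[y Gy ky]]; apply/asboolP.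
    by exists 0; [case: linG | apply: killed_by_pow0].
  by exists (c *: x + y); [apply: linG.2 | apply: killed_by_powP].
have [k v||k kP] := @fg_sub_exhaust _ _ N (fun k => Submodule _ (T_closed k)) fgN.
- move=> /asboolP[z Gz kz]; apply/asboolP; exists z => //.
  exact: killed_by_pow_le kz.
- move=> v /GN[z Gz]; have /asboolP[k kz] := valP z.
  by exists k; apply/asboolP; exists z.
exists k => v z /kP/asboolP[z' Gz' kz'] Gz.
by rewrite (functional_relP linG funG Gz Gz').
Qed.

Hypothesis noethR : noetherian R.

(** Artin-Rees in the form needed for Baer's criterion.  A map [f : J -> Gamma I]
    from an ideal is killed by some [a^k].  An ideal [K] maximal among those
    containing the kernel of [f] and meeting [J] only in that kernel contains
    some [a^N]: for [x] in [a], when the chain [(K : x^n)] is stationary from [n]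
    on, adding [x^n] to [K] does not enlarge the intersection with [J].
    Extending [f] by zero on [K], and then to the ring, yields an element [y] of
    [I] that is killed by [K], hence is torsion. *)
Lemma Gamma_injective I : injective_module I -> injective_module (Gamma I).
Proof.
move=> injI; apply: baer_injective => G linG funG.
have dom_closed : submod_closed [pred r : R^o | `[< exists z, G r z >]].
  split=> [|c r s /asboolP[x Gx] /asboolP[y Gy]]; apply/asboolP.
    by exists 0; case: linG.
  by exists (c *: x + y); apply: linG.2.
have [k kG] : exists k, forall r z, G r z -> killed_by_pow k (val z).
  have [|k kP] := torsion_bounded (noethR (Submodule _ dom_closed)) linG funG.
    by move=> r /asboolP.
  by exists k => r z Gz; apply: (kP r) => //; apply/asboolP; exists z.
have ker_closed : submod_closed [pred r : R^o | `[< G r 0 >]].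
  split=> [|c r s /asboolP Gr /asboolP Gs]; apply/asboolP; first by case: linG.
  by rewrite -(addr0 0) -{1}(scaler0 _ c); apply: linG.2.
pose P (K : ideal R) := (forall r, G r 0 -> r \in K) /\
  (forall r z, r \in K -> G r z -> z = 0).
have [|K [QK KJ] maxK] := @maximal_ideal_exists R noethR P (Submodule _ ker_closed).
  split=> [r Gr|r z /asboolP Gr Gz]; first exact/asboolP.
  exact: (functional_relP linG funG Gz Gr).
have [N NK] : nilpotent_mod a K.
  apply: nilpotent_modP => // x xa.
  have [j r|n nP] := @ascending_chain R noethR (fun j => colon K (x ^+ j)).
    by rewrite !inE exprSr mulrA [_ * x]mulrC; apply: idealMl.
  exists n; apply: (maxK (adjoin K (x ^+ n))); [|exact: sub_adjoin|exact: mem_adjoin].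
  split=> [r /QK|r z /asboolP[u [c [uK rE]]] Gz]; first exact: sub_adjoin.
  apply: (KJ _ _ _ Gz); rewrite rE; apply: rpredD => //.
  (* [x^k r] is in the kernel, hence in [K], and so is [c x^(n+k)]; as the chain
     is stationary, [c x^n] is in [K] too. *)
  have Gxr : G (x ^+ k *: r) 0.
    have := linear_relZ (x ^+ k) linG Gz; suff -> : x ^+ k *: z = 0 by [].
    apply: Gamma_val0; rewrite linearZ /=; apply: (kG _ _ Gz).
    exact: ideal_pow_expr.
  have cx : c * x ^+ (n + k) \in K.
    have -> : c * x ^+ (n + k) = x ^+ k * r - x ^+ k * u.
      rewrite rE mulrDr addrAC subrr add0r exprD mulrC -!mulrA mulrCA.
      by rewrite [c * _]mulrC mulrA.
    by apply: rpredB; [apply: QK | apply: idealMl].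
  by apply: (nP (n + k)%N); rewrite inE.
(* The extension of [f] by zero on [K]. *)
pose H (r : R^o) (v : I) := exists u z, [/\ u \in K, G (r - u) z & v = val z].
have [||f fP] := injI _ H.
- split; first by exists 0, 0; rewrite rpred0 subr0; split=> //; case: linG.
  move=> c r _ r' _ [u [z [uK Gz ->]]] [u' [z' [uK' Gz' ->]]].
  exists (c *: u + u'), (c *: z + z'); split=> //.
    by apply: rpredD => //; apply: rpredZ.
  by rewrite opprD addrACA -scalerBr; apply: linG.2.
- move=> _ [u [z [uK Gz ->]]]; suff -> : z = 0 by [].
  by apply: (KJ _ z _ Gz); rewrite sub0r rpredN.
have fE (r : R) : f r = r *: f 1.
  by rewrite -linearZ; congr (f _); rewrite /GRing.scale /= mulr1.
have f1 : f 1 \in torsion I.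
  apply/asboolP; exists N => t /NK tK; rewrite -fE; apply: fP.
  by exists t, 0; rewrite subrr; split=> //; case: linG.
exists (Subm f1) => r z Gz; apply: val_inj; rewrite linearZ /= -fE; apply: fP.
by exists 0, z; rewrite rpred0 subr0.
Qed.

End Torsion.

(** * The long exact cohomology sequence *)

Section ShortExact.
Variables (R : comNzRingType).
Implicit Types V W X : lmodType R.

Definition short_exact V W X (f : {linear V -> W}) (g : {linear W -> X}) :=
  [/\ forall v, f v = 0 -> v = 0, forall w, g w = 0 <-> exists v, f v = w &
      forall x, exists w, g w = x].

Lemma short_exact_comp0 V W X (f : {linear V -> W}) (g : {linear W -> X}) v :
  short_exact f g -> g (f v) = 0.
Proof. by case=> _ /(_ (f v)) fg _; apply/fg; exists v. Qed.

End ShortExact.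
Section CohomologyClasses.
Variables (R : comNzRingType).
Implicit Types C D : cochain_complex R.

(** A relation, and not a function on the subtype of cocycles, so that
    representatives are elements of the complex itself. *)
Definition has_class C i (z : C i) (x : cohomology C i) :=
  exists z' : subm (cocycles C i), (val z' : C i) = z /\ qproj _ z' = x.

Lemma has_class_linear C i : linear_rel (@has_class C i).
Proof.
split; first by exists 0; rewrite !linear0.
by move=> c _ _ _ _ [z [<- <-]] [z' [<- <-]]; exists (c *: z + z'); rewrite !linearP.
Qed.

Lemma has_class_cocycle C i (z : C i) x : has_class z x -> cc_d C i z = 0.
Proof. by case=> z' [<- _]; apply/eqP/(valP z'). Qed.

Lemma cocycle_class C i (z : C i) : cc_d C i z = 0 -> exists x, has_class z x.
Proof.
move=> /eqP z0; have zc : z \in cocycles C i by [].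
by exists (qproj _ (Subm zc)), (Subm zc).
Qed.

Lemma class_repr C i (x : cohomology C i) : exists z, has_class z x.
Proof. by exists (val (repr x)), (repr x); rewrite qproj_surj. Qed.

Lemma has_class_inj C i (z : C i) x y : has_class z x -> has_class z y -> x = y.
Proof. by move=> [u [uz <-]] [v [vz <-]]; congr qproj; apply: val_inj; rewrite uz. Qed.

Lemma has_class0P C i (z : C i) : has_class z 0 <-> z \in coboundaries C i.
Proof.
split=> [[z' [<- /eqP]]|zB].
  by rewrite -(linear0 (qproj (boundary_sub C i))) qprojP subr0.
have zc : z \in cocycles C i.
  case: i z zB => [|i] z; first by rewrite inE => /eqP ->; rewrite !inE linear0.
  by move=> /asboolP[y <-]; rewrite inE cc_dd.
exists (Subm zc); split=> //; apply/eqP.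
by rewrite -(linear0 (qproj (boundary_sub C i))) qprojP subr0.
Qed.

Lemma has_class_map C D (f : cochain_map C D) i (z : C i) x :
  has_class z x -> has_class (f i z) (cohomology_map f i x).
Proof.
move=> [z' [<- <-]]; exists (Defs.sub_map (@cocycles_map R C D f i) z').
by split=> //; rewrite [RHS]quot_mapE.
Qed.

Lemma cohomology_map_eq C D (f : cochain_map C D) i (z : C i) x y :
  has_class z x -> has_class (f i z) y -> cohomology_map f i x = y.
Proof. by move=> /has_class_map -/(_ _ f) fz; apply: has_class_inj. Qed.

End CohomologyClasses.

Section LongExactSequence.
Variables (R : comNzRingType) (A B C : cochain_complex R).
Variables (f : cochain_map A B) (g : cochain_map B C).
Hypothesis exact_fg : forall i, short_exact (f i) (g i).

(** Used to replace an element of [B] lying over a representative of a zero class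
    by one lying over 0, without changing its differential; in degree 0 the
    correction is 0. *)
Lemma coboundary_lift i (c : C i) : c \in coboundaries C i ->
  exists2 b, b \in coboundaries B i & g i b = c.
Proof.
case: i c => [|i] c; first by rewrite inE => /eqP ->; exists 0; rewrite ?inE ?linear0.
move=> /asboolP[c' <-]; have [_ _ /(_ c')[b <-]] := exact_fg i.
by exists (cc_d B i b); [apply/asboolP; exists b | rewrite cm_comm].
Qed.

Lemma cohomology_map_comp0 i x :
  cohomology_map g i (cohomology_map f i x) = 0.
Proof.
have [z zx] := class_repr x.
apply: cohomology_map_eq (has_class_map _ zx) _.
by rewrite (short_exact_comp0 _ (exact_fg i)); case: (has_class_linear C i).
Qed.

Lemma cohomology_exact_mid i x :
  cohomology_map g i x = 0 <-> exists y, cohomology_map f i y = x.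
Proof.
split=> [gx|[y <-]]; last exact: cohomology_map_comp0.
have [z zx] := class_repr x.
have := has_class_map g zx; rewrite gx => /has_class0P/coboundary_lift[b bB gb].
have [_ /(_ (z - b))[+ _] _] := exact_fg i.
rewrite linearB gb subrr => /(_ erefl) [u fu].
have fux : has_class (f i u) x.
  rewrite fu -[x]subr0; apply: linear_relB => //; first exact: has_class_linear.
  exact/has_class0P.
have [f0 _ _] := exact_fg i.+1.
have [y uy] : exists y, has_class u y.
  by apply: cocycle_class; apply: f0; rewrite cm_comm (has_class_cocycle fux).
by exists y; apply: cohomology_map_eq uy fux.
Qed.

Lemma cohomology_map0_inj x : cohomology_map f 0 x = 0 -> x = 0.
Proof.
have [z zx] := class_repr x.
have := has_class_map f zx => /[swap] -> /has_class0P; rewrite inE => /eqP fz.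
have [f0 _ _] := exact_fg 0; move: zx; rewrite (f0 _ fz) => zx.
by apply: has_class_inj zx _; case: (has_class_linear A 0).
Qed.

(** The graph of the connecting map of the snake lemma. *)
Definition connects i (x : cohomology C i) (y : cohomology A i.+1) :=
  exists b a, [/\ has_class (g i b) x, f i.+1 a = cc_d B i b & has_class a y].

Lemma connecting_exists i : exists delta : {linear cohomology C i -> cohomology A i.+1},
  [/\ forall x y, connects x y -> delta x = y,
      forall x, delta x = 0 <-> exists y, cohomology_map g i y = x &
      forall x, cohomology_map f i.+1 x = 0 <-> exists y, delta y = x].
Proof.
have [f0 fg gs] := exact_fg i; have [f0' fg' gs'] := exact_fg i.+1.
have linC := has_class_linear C i; have linA := has_class_linear A i.+1.
have [|||delta dP] := @graph_linear _ _ _ (@connects i).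
- split; first by exists 0, 0; rewrite !linear0; split=> //; [case: linC | case: linA].
  move=> c x y x' y' [b [u [bx fu uy]]] [b' [u' [bx' fu' uy']]].
  exists (c *: b + b'), (c *: u + u'); rewrite !linearP /= fu fu'.
  by split=> //; [apply: linC.2 | apply: linA.2].
- move=> y [b [u [/has_class0P/coboundary_lift[b' b'B gb] fu uy]]].
  have [|u' fu'] := (fg (b - b')).1; first by rewrite linearB gb subrr.
  have -> : y = 0; last by [].
  apply: has_class_inj uy _; apply/has_class0P/asboolP; exists u'.
  apply/eqP; rewrite -subr_eq0; apply/eqP/f0'.
  rewrite linearB /= cm_comm fu' fu linearB /=.
  by rewrite (has_class_cocycle (proj2 (has_class0P _) b'B)) subr0 subrr.
- move=> x; have [c cx] := class_repr x; have [b bc] := gs c.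
  have [|u fu] := (fg' (cc_d B i b)).1.
    by rewrite cm_comm bc (has_class_cocycle cx).
  have [|y uy] := @cocycle_class _ A i.+1 u; last by exists y, b, u; rewrite bc.
  by have [f0'' _ _] := exact_fg i.+2; apply: f0''; rewrite cm_comm fu cc_dd.
exists delta; split=> [x y /dP //|x|x]; split.
- move=> /dP[b [u [bx fu /has_class0P/asboolP[u' uE]]]].
  have gbu : g i (b - f i u') = g i b.
    by rewrite linearB (short_exact_comp0 _ (exact_fg i)) subr0.
  have [|y by_] := @cocycle_class _ B i (b - f i u').
    by rewrite linearB /= -fu -uE cm_comm subrr.
  by exists y; apply: cohomology_map_eq by_ _; rewrite gbu.
- move=> [y <-]; apply/dP; have [b by_] := class_repr y.
  exists b, 0; rewrite linear0 (has_class_cocycle by_); split=> //.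
    exact: has_class_map.
  by case: linA.
- move=> fx; have [u ux] := class_repr x.
  have := has_class_map f ux; rewrite fx => /has_class0P/asboolP[b bu].
  have [|y by_] := @cocycle_class _ C i (g i b).
    by rewrite -cm_comm bu (short_exact_comp0 _ (exact_fg i.+1)).
  by exists y; apply/dP; exists b, u.
- move=> [y /dP[b [u [bx fu uy]]]].
  apply: cohomology_map_eq uy _; apply/has_class0P; rewrite fu.
  by apply/asboolP; exists b.
Qed.

Definition connecting i := projT1 (cid (connecting_exists i)).

Lemma connectingP i x y : connects x y -> connecting i x = y.
Proof. by rewrite /connecting; case: cid => d [+ _ _] /=; apply. Qed.

Lemma connecting_ker i x :
  connecting i x = 0 <-> exists y, cohomology_map g i y = x.
Proof. by rewrite /connecting; case: cid => d []. Qed.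

Lemma connecting_im i x :
  cohomology_map f i.+1 x = 0 <-> exists y, connecting i y = x.
Proof. by rewrite /connecting; case: cid => d []. Qed.

End LongExactSequence.
(** * Functoriality of homomorphisms and of Ext in the second variable *)

Section HomModules.
Variables (R : comNzRingType).
Implicit Types V W X Y Z : lmodType R.

Fact linear_hom V W (f : {linear V -> W}) : (f : V -> W) \in hom_sub V W.
Proof. by apply/asboolP; apply: linearP. Qed.
Definition to_hom V W (f : {linear V -> W}) : hom_mod V W := Subm (linear_hom f).

Definition of_hom V W (h : hom_mod V W) : {linear V -> W} :=
  HB.pack (subm_val h) (GRing.isLinear.Build R V W *:%R _ (hom_linear h)).

Lemma hom_eqP V W (h k : hom_mod V W) :
  (forall v, subm_val h v = subm_val k v) -> h = k.
Proof. by move=> hk; apply/val_inj/funext. Qed.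

Definition push V X Y (f : {linear X -> Y}) (h : hom_mod V X) : hom_mod V Y :=
  to_hom (f \o of_hom h).

Fact push_linear V X Y (f : {linear X -> Y}) : linear (@push V X Y f).
Proof. by move=> c h k; apply: hom_eqP => v; apply: linearP. Qed.
HB.instance Definition _ V X Y (f : {linear X -> Y}) :=
  GRing.isLinear.Build R (hom_mod V X) (hom_mod V Y) *:%R (@push V X Y f)
    (push_linear f).

Lemma push_pullback V W X Y (u : {linear V -> W}) (f : {linear X -> Y}) h :
  push f (pullback u h) = pullback u (push f h).
Proof. exact: hom_eqP. Qed.

Lemma push_inj V X Y (f : {linear X -> Y}) (h : hom_mod V X) :
  (forall x, f x = 0 -> x = 0) -> push f h = 0 -> h = 0.
Proof.
move=> f0 fh; apply: hom_eqP => v; apply: f0.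
exact: (congr1 (fun k : hom_mod V Y => subm_val k v) fh).
Qed.

Lemma push_lift V X Y (f : {linear X -> Y}) (h : hom_mod V Y) :
  (forall x, f x = 0 -> x = 0) -> (forall v, exists x, f x = subm_val h v) ->
  exists k, push f k = h.
Proof.
move=> f0 hf.
have [||//|k kP] := @graph_linear _ V X (fun v x => f x = of_hom h v).
- split=> [|c v x v' x' fx fx']; first by rewrite !linear0.
  by rewrite !linearP fx fx'.
- by move=> x; rewrite linear0; apply: f0.
by exists (to_hom k); apply: hom_eqP => v; apply/kP.
Qed.

Lemma push_left_exact V X Y Z (f : {linear X -> Y}) (g : {linear Y -> Z})
    (h : hom_mod V Y) :
  short_exact f g -> push g h = 0 <-> exists k, push f k = h.
Proof.
move=> fg; have [f0 exact_fg _] := fg; split=> [gh|[k <-]]; last first.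
  by apply: hom_eqP => v; apply: (short_exact_comp0 _ fg).
apply: push_lift => // v; apply/exact_fg.
exact: (congr1 (fun k : hom_mod V Z => subm_val k v) gh).
Qed.

Lemma push_free_surj V X Y (g : {linear X -> Y}) (h : hom_mod (Free V) Y) :
  (forall y, exists x, g x = y) -> exists k, push g k = h.
Proof.
move=> gs.
have [l lP] := choice (fun v : V => gs (of_hom h << v >>)).
exists (to_hom (free_lift l)); apply: hom_eqP.
apply: (free_ext (f := g \o free_lift l) (g := of_hom h)) => v.
by rewrite /= free_liftU scale1r lP.
Qed.

(** Free modules are projective; this is where the long exact sequence of Ext in
    its second variable comes from. *)
Lemma push_free_exact V X Y Z (f : {linear X -> Y}) (g : {linear Y -> Z}) :
  short_exact f g ->
  short_exact (@push (Free V) X Y f) (@push (Free V) Y Z g).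
Proof.
move=> fg; have [f0 _ gs] := fg; split=> [h|h|h].
- exact: push_inj.
- exact: push_left_exact.
- exact: push_free_surj.
Qed.

(** A map that kills the kernel of a surjection factors through it. *)
Lemma pullback_lift V W X (u : {linear V -> W}) (h : hom_mod V X) :
  (forall w, exists v, u v = w) -> (forall v, u v = 0 -> subm_val h v = 0) ->
  exists k, pullback u k = h.
Proof.
move=> us uh.
have [|||k kP] := @graph_linear _ W X (fun w x => exists2 v, u v = w & of_hom h v = x).
- split; first by exists 0; rewrite linear0.
  move=> c _ _ _ _ [v <- <-] [v' <- <-].
  by exists (c *: v + v'); rewrite linearP.
- by move=> x [v /uh + <-].
- by move=> w; have [v vw] := us w; exists (of_hom h v), v.
by exists (to_hom k); apply: hom_eqP => v; apply/kP; exists v.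
Qed.

End HomModules.

Section ExtFunctor.
Variables (R : comNzRingType).
Implicit Types N V W X Y Z : lmodType R.

Fact hom_push_comm N X Y (f : {linear X -> Y}) i (h : hom_complex N X i) :
  push f (cc_d (hom_complex N X) i h) = cc_d (hom_complex N Y) i (push f h).
Proof. exact: hom_eqP. Qed.

Definition hom_push N X Y (f : {linear X -> Y}) :
    cochain_map (hom_complex N X) (hom_complex N Y) :=
  @CochainMap R (hom_complex N X) (hom_complex N Y)
    (fun i => push f) (@hom_push_comm N X Y f).

Definition Ext_push i N X Y (f : {linear X -> Y}) :
    {linear Ext i N X -> Ext i N Y} :=
  cohomology_map (hom_push N f) i.

Lemma hom_push_exact N X Y Z (f : {linear X -> Y}) (g : {linear Y -> Z}) :
  short_exact f g -> forall i, short_exact (hom_push N f i) (hom_push N g i).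
Proof. by move=> fg i; apply: push_free_exact. Qed.

Lemma Ext_push_zero i N X (x : Ext i N X) : is_zero X -> x = 0.
Proof.
move=> X0; have [z zx] := class_repr x.
apply: has_class_inj zx _.
have -> : z = 0 by apply: hom_eqP => v; rewrite [LHS]X0 [RHS]X0.
by case: (has_class_linear (hom_complex N X) i).
Qed.

(** A cocycle [z] vanishes on the kernel of [F_(i+1) -> F_i], which is the image of
    [F_(i+2)], so it is the pullback of a map defined on the image of [F_(i+1)] in
    [F_i], and that map extends to [F_i]. *)
Lemma Ext_injective i N X (x : Ext i.+1 N X) : injective_module X -> x = 0.
Proof.
move=> injX; have [z zx] := class_repr x.
have dz := has_class_cocycle zx.
have zd y : of_hom z (res_d N i.+1 y) = 0.
  exact: (congr1 (fun k : hom_mod (res N i.+2) X => subm_val k y) dz).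
have [||k kP] := injX (res N i)
    (fun v w => exists2 u, res_d N i u = v & of_hom z u = w).
- split; first by exists 0; rewrite linear0.
  move=> c _ _ _ _ [u <- <-] [u' <- <-].
  by exists (c *: u + u'); rewrite linearP.
- by move=> w [u /res_exactS[y <-] <-]; apply: zd.
apply: has_class_inj zx _; apply/has_class0P/asboolP; exists (to_hom k).
by apply: hom_eqP => u; apply: kP; exists u.
Qed.

Section LongExactExt.
Variables (N X Y Z : lmodType R) (f : {linear X -> Y}) (g : {linear Y -> Z}).
Hypothesis fg : short_exact f g.

Definition Ext_delta i : {linear Ext i N Z -> Ext i.+1 N X} :=
  connecting (hom_push_exact N fg) i.

Lemma Ext_delta_ker i x : Ext_delta i x = 0 <-> exists y, Ext_push i N g y = x.
Proof. exact: connecting_ker. Qed.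

Lemma Ext_delta_im i x :
  Ext_push i.+1 N f x = 0 <-> exists y, Ext_delta i y = x.
Proof. exact: connecting_im. Qed.

Lemma Ext_push_mid i x : Ext_push i N g x = 0 <-> exists y, Ext_push i N f y = x.
Proof. exact/cohomology_exact_mid/hom_push_exact. Qed.

Lemma Ext0_push_inj x : Ext_push 0 N f x = 0 -> x = 0.
Proof. exact: (cohomology_map0_inj (hom_push_exact N fg)). Qed.

End LongExactExt.

(** The lift [b] and its preimage [a] under the injection, once chosen over [N'],
    pull back to admissible choices over [N]. *)
Lemma Ext_delta_natural (N N' : lmodType R) (u : {linear N -> N'}) X Y Z
    (f : {linear X -> Y}) (g : {linear Y -> Z}) (fg : short_exact f g) i x :
  Ext_map i.+1 X u (Ext_delta N' fg i x) = Ext_delta N fg i (Ext_map i Z u x).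
Proof.
have [c cx] := class_repr x.
have [b bc] := @push_free_surj _ _ _ _ g c (let: And3 _ _ gs := fg in gs).
have [a ab] : exists a, hom_push N' f i.+1 a = cc_d (hom_complex N' Y) i b.
  apply/(push_left_exact _ fg).
  by rewrite [LHS]hom_push_comm bc; apply: has_class_cocycle cx.
have [y ay] : exists y, has_class (C := hom_complex N' X) (i := i.+1) a y.
  have [f0 _ _] := fg; apply: cocycle_class; apply: (push_inj f0).
  rewrite [LHS]hom_push_comm -[push f a]/(hom_push N' f i.+1 a) ab.
  exact: (@cc_dd R (hom_complex N' Y) i b).
have -> : Ext_delta N' fg i x = y by apply: connectingP; exists b, a; rewrite /= bc.
apply/esym/connectingP.
exists (hom_complex_map Y u i b), (hom_complex_map X u i.+1 a); split.
- have := has_class_map (hom_complex_map Z u) cx; rewrite -bc.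
  by rewrite -[hom_complex_map Z u i _]/(pullback _ (push g b)) -push_pullback.
- rewrite -cm_comm -ab; exact: push_pullback.
- exact: has_class_map.
Qed.

Section ExtZero.
Variables N X : lmodType R.

(** The augmentation induces [Hom(N, X) = Ext^0(N, X)]. *)
Lemma hom_Ext0_exists : exists e : {linear hom_mod N X -> Ext 0 N X},
  forall h x,
    has_class (C := hom_complex N X) (i := 0) (pullback (aug N) h) x <-> e h = x.
Proof.
have linE := has_class_linear (hom_complex N X) 0.
apply: graph_linear.
- split=> [|c h x h' x' hx hx']; first by rewrite linear0; case: linE.
  by rewrite linearP; apply: linE.2.
- by move=> x; rewrite linear0 => hx; apply: has_class_inj hx _; case: linE.
- move=> h; apply: cocycle_class; apply: hom_eqP => y.
  rewrite -[LHS]/(of_hom h (aug N (res_d N 0 y))).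
  by rewrite (proj2 (res_exact0 _)) ?linear0 //; exists y.
Qed.

Definition hom_Ext0 := projT1 (cid hom_Ext0_exists).

Lemma hom_Ext0P h x :
  has_class (C := hom_complex N X) (i := 0) (pullback (aug N) h) x <-> hom_Ext0 h = x.
Proof. by rewrite /hom_Ext0; case: cid => e /= ->. Qed.

Lemma hom_Ext0_inj h : hom_Ext0 h = 0 -> h = 0.
Proof.
move=> /hom_Ext0P/has_class0P/eqP h0; apply: hom_eqP => v.
have [D <-] := aug_surj v.
exact: (congr1 (fun k : hom_mod (Free N) X => subm_val k D) h0).
Qed.

Lemma hom_Ext0_surj x : exists h, hom_Ext0 h = x.
Proof.
have [z zx] := class_repr x; have dz := has_class_cocycle zx.
have [|D D0|h hz] := @pullback_lift _ _ _ _ (aug N) z.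
- exact: aug_surj.
- have [y <-] := (res_exact0 D).1 D0.
  exact: (congr1 (fun k : hom_mod (res N 1) X => subm_val k y) dz).
by exists h; apply/hom_Ext0P; rewrite hz.
Qed.

End ExtZero.
Arguments hom_Ext0 {N X}.

Lemma hom_Ext0_pullback (N N' X : lmodType R) (u : {linear N -> N'}) (h : hom_mod N' X) :
  hom_Ext0 (pullback u h) = Ext_map 0 X u (hom_Ext0 h).
Proof.
apply/hom_Ext0P; have /hom_Ext0P hx := erefl (hom_Ext0 h).
have := has_class_map (hom_complex_map X u) hx.
congr has_class; apply: hom_eqP => D.
by rewrite -[LHS]/(of_hom h (aug N' (free_map u D))) aug_free_map.
Qed.

Lemma hom_Ext0_push N X Y (f : {linear X -> Y}) (h : hom_mod N X) :
  hom_Ext0 (push f h) = Ext_push 0 N f (hom_Ext0 h).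
Proof.
apply/hom_Ext0P; have /hom_Ext0P hx := erefl (hom_Ext0 h).
have := has_class_map (hom_push N f) hx.
by congr has_class; apply: hom_eqP.
Qed.

End ExtFunctor.
Arguments hom_Ext0 {R N X}.
(** * Injective coresolutions and dimension shifting *)

Section Coresolutions.
Variable R : comNzRingType.

(** An injective coresolution [I_0 -> I_1 -> ...], cut into the short exact
    sequences [0 -> X_i -> I_i -> X_(i+1) -> 0]; it resolves [X_0]. *)
Record coresolution := Coresolution {
  cosyzygy :> nat -> lmodType R;
  cr_inj : nat -> lmodType R;
  cr_in : forall i, {linear cosyzygy i -> cr_inj i};
  cr_out : forall i, {linear cr_inj i -> cosyzygy i.+1};
  cr_exact : forall i, short_exact (cr_in i) (cr_out i);
  cr_injective : forall i, injective_module (cr_inj i)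
}.

Definition cr_shift (D : coresolution) : coresolution :=
  @Coresolution (fun i => D i.+1) (fun i => cr_inj D i.+1)
    (fun i => cr_in D i.+1) (fun i => cr_out D i.+1)
    (fun i => cr_exact D i.+1) (fun i => @cr_injective D i.+1).

(** The map [I_(i-1) -> X_i].  For [i = 0] it is the zero map, from [I_0] because
    [0.-1 = 0]; its cokernel after applying [Hom(N, _)] is then [Ext^i(N, X_0)]
    in all degrees, 0 included. *)
Definition cr_prev (D : coresolution) i : {linear cr_inj D i.-1 -> D i} :=
  match i with 0 => \0 | j.+1 => cr_out D j end.

Section CofreeCoresolution.
Variable X : lmodType R.

Definition cofree_coker (V : lmodType R) : lmodType R :=
  quotm (im (to_cofree V : {linear V -> cofree V})).

Lemma cofree_exact (V : lmodType R) :
  short_exact (to_cofree V : {linear V -> cofree V})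
    (qproj (im (to_cofree V : {linear V -> cofree V}))
     : {linear cofree V -> cofree_coker V}).
Proof.
split=> [v|w|x].
- exact: to_cofree_inj.
- rewrite -[qproj _ w = 0]/(_ = _ :> cofree_coker V).
  rewrite -(linear0 (qproj (im (to_cofree V : {linear V -> cofree V})))).
  split=> [/eqP|wi]; first by rewrite qprojP subr0 => /asboolP.
  by apply/eqP; rewrite qprojP subr0; apply/asboolP.
- by exists (repr x); apply: qproj_surj.
Qed.

Definition cofree_coresolution : coresolution :=
  @Coresolution (fun i => iter i cofree_coker X)
    (fun i => cofree (iter i cofree_coker X)) _ _
    (fun i => cofree_exact (iter i cofree_coker X))
    (fun i => @cofree_injective R _).

End CofreeCoresolution.

(** The iterated connecting map of dimension shifting.  The recursion shifts the
    coresolution and not the degree in it, so that types match by computation. *)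
Fixpoint Ext_of_hom q : forall (D : coresolution) (N : lmodType R),
    {linear hom_mod N (D q) -> Ext q N (D 0)} :=
  match q with
  | 0 => fun D N => hom_Ext0
  | j.+1 => fun D N =>
      Ext_delta N (cr_exact D 0) j \o Ext_of_hom j (cr_shift D) N
  end.

Lemma Ext_of_hom_natural q (D : coresolution) (N N' : lmodType R)
    (u : {linear N -> N'}) (h : hom_mod N' (D q)) :
  Ext_of_hom q D N (pullback u h) = Ext_map q (D 0) u (Ext_of_hom q D N' h).
Proof.
elim: q D h => [|q IH] D h /=; first exact: hom_Ext0_pullback.
by rewrite Ext_delta_natural; congr (Ext_delta _ _ _ _); exact: (IH (cr_shift D) h).
Qed.

Lemma Ext_of_hom_surj q (D : coresolution) (N : lmodType R) x :
  exists h, Ext_of_hom q D N h = x.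
Proof.
elim: q D x => [|q IH] D x; first exact: hom_Ext0_surj.
have [y <-] : exists y, Ext_delta N (cr_exact D 0) q y = x.
  by apply/Ext_delta_im; apply: Ext_injective; apply: cr_injective.
by have [h <-] := IH (cr_shift D) y; exists h.
Qed.

(** Connecting maps out of [Ext^j] are injective for [j > 0], as injective modules
    have no higher Ext; so only the innermost one, out of [Ext^0], has a kernel, made of
    the homomorphisms that lift to [I_(q-1)]. *)
Lemma Ext_of_hom_ker q (D : coresolution) (N : lmodType R) (h : hom_mod N (D q)) :
  Ext_of_hom q D N h = 0 <-> exists g, push (cr_prev D q) g = h.
Proof.
elim: q D h => [|q IH] D h.
  split=> [/hom_Ext0_inj ->|[g <-]]; first by exists 0; rewrite linear0.
  by have -> : push (cr_prev D 0) g = 0; [apply: hom_eqP | rewrite linear0].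
rewrite -[Ext_of_hom _ _ _ _]/(Ext_delta _ _ _ (Ext_of_hom q (cr_shift D) N h)).
rewrite Ext_delta_ker; case: q IH h => [|q] IH h.
  split=> [[y]|[g <-]]; last by exists (hom_Ext0 g); rewrite -hom_Ext0_push.
  have [g <-] := hom_Ext0_surj y; rewrite -hom_Ext0_push => gh.
  exists g; apply/eqP; rewrite -subr_eq0; apply/eqP/hom_Ext0_inj.
  by rewrite linearB; apply/eqP; rewrite subr_eq0; apply/eqP.
rewrite -(IH (cr_shift D) h); split=> [[y <-]|->]; last by exists 0; rewrite linear0.
by rewrite (Ext_injective y (@cr_injective D 0)) linear0.
Qed.

End Coresolutions.
(** * Sequential direct limits *)

Section DirectLimits.
Variables (R : comNzRingType) (E : nat -> lmodType R).
Variable phi : forall k, {linear E k -> E k.+1}.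

Definition dirlim_in k (x : E k) : dirlim phi :=
  qproj (dirlim_rel phi) (dsum_in x).

Lemma dsum_in_self k (x : E k) : (val (dsum_in x) : dprod E) k = x.
Proof. exact: dfwith_in. Qed.

Lemma dsum_in_other k (x : E k) j : j != k -> (val (dsum_in x) : dprod E) j = 0.
Proof. by move=> jk; apply: dfwith_out; rewrite eq_sym. Qed.

Lemma dsum_in_linear k : linear (@dsum_in R E k).
Proof.
move=> c x y; apply/val_inj/functional_extensionality_dep => j.
rewrite -[RHS]/(c *: (val (dsum_in x) : dprod E) j + (val (dsum_in y) : dprod E) j).
have [->|kj] := eqVneq j k; first by rewrite !dsum_in_self.
by rewrite !dsum_in_other // scaler0 addr0.
Qed.

Lemma dirlim_in_linear k : linear (@dirlim_in k).
Proof.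
by move=> c x y; rewrite /dirlim_in dsum_in_linear; apply: linearP.
Qed.
HB.instance Definition _ k := GRing.isLinear.Build R (E k) (dirlim phi) *:%R
  (@dirlim_in k) (@dirlim_in_linear k).

Lemma dirlim_in_phi k (x : E k) : dirlim_in (phi k x) = dirlim_in x.
Proof.
apply/esym/eqP; rewrite qprojP.
by apply: sub_gen; exists k, x.
Qed.

Lemma dirlim_in_le k l (x : E k) : (k <= l)%N ->
  exists y : E l, dirlim_in y = dirlim_in x.
Proof.
move=> /subnK <-; elim: (l - k)%N => [|d [y <-]]; first by exists x.
by exists (phi _ y); apply: dirlim_in_phi.
Qed.

Lemma dirlim_in_surj e : exists k (x : E k), dirlim_in x = e.
Proof.
have [s <-] : exists s, qproj (dirlim_rel phi) s = e.
  by exists (repr e); apply: qproj_surj.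
have /asboolP[K] := valP s; elim: K s => [|K IH] s s0.
  exists 0%N, 0; rewrite linear0.
  have -> : s = 0; last by rewrite linear0.
  by apply/val_inj/functional_extensionality_dep => k; apply: s0.
have [k Kk|k [x xE]] := IH (s - dsum_in ((val s : dprod E) K)).
  rewrite -[LHS]/((val s : dprod E) k - (val (dsum_in ((val s : dprod E) K)) : dprod E) k).
  have [->|kK] := eqVneq k K; first by rewrite dsum_in_self subrr.
  by rewrite dsum_in_other // subr0 s0 // ltn_neqAle eq_sym kK.
have [y yE] := dirlim_in_le x (leq_maxl k K).
have [z zE] := dirlim_in_le ((val s : dprod E) K) (leq_maxr k K).
exists (maxn k K), (y + z); rewrite linearD /= yE zE xE linearB /=.
by rewrite subrK.
Qed.

(** The sum of the images in [E k] of the components of [s] of index below [k].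
    On a generator [dsum_in x - dsum_in (phi k x)] of the relations it becomes
    and stays zero, so it detects the elements that die in the limit. *)
Fixpoint transported (s : dprod E) k : E k :=
  match k with 0 => 0 | j.+1 => phi j (transported s j + s j) end.

Lemma transportedS s k : transported s k.+1 = phi k (transported s k + s k).
Proof. by []. Qed.

Lemma transported_linear k : linear (transported^~ k).
Proof.
move=> c s t; elim: k => [|k IH] /=; first by rewrite scaler0 addr0.
rewrite -[(c *: s + t) k]/(c *: s k + t k) -linearZ -linearD; congr (phi k _).
by rewrite IH scalerDr addrACA.
Qed.

Lemma transported_in k (x : E k) l : (l <= k)%N ->
  transported (val (dsum_in x)) l = 0.
Proof.
elim: l => [//|l IH] lk.
by rewrite transportedS IH 1?ltnW // dsum_in_other ?addr0 ?linear0 // neq_ltn lk.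
Qed.

Fact vanishing_closed : submod_closed [pred s : dsum E |
  `[< exists K, forall k, (K <= k)%N -> transported (val s) k = 0 >]].
Proof.
split=> [|c s t /asboolP[K sK] /asboolP[L tL]]; apply/asboolP.
  exists 0%N => k _; elim: k => [//|k /= ->].
  by rewrite add0r linear0.
exists (maxn K L) => k; rewrite geq_max => /andP[Kk Lk].
by rewrite linearP [LHS]transported_linear sK // tL // scaler0 addr0.
Qed.

Lemma dirlim_rel_vanishing s : s \in dirlim_rel phi ->
  exists K, forall k, (K <= k)%N -> transported (val s) k = 0.
Proof.
suff /[apply] : {subset dirlim_rel phi <= Submodule _ vanishing_closed}.
  by move=> /asboolP.
apply: gen_min => _ [k [x ->]]; apply/asboolP; exists k.+2 => l.
have tB j : transported (val (dsum_in x - dsum_in (phi k x))) j =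
    transported (val (dsum_in x)) j - transported (val (dsum_in (phi k x))) j.
  rewrite -[_ - dsum_in _]addrC -scaleN1r linearP [LHS]transported_linear.
  by rewrite scaleN1r addrC.
move=> /subnK <-; elim: (l - _)%N => [|d IH].
  rewrite add0n tB !transportedS.
  rewrite !(@transported_in k) // (@transported_in k.+1) //.
  have k1 : k.+1 != k by rewrite neq_ltn ltnSn orbT.
  rewrite !dsum_in_self !add0r dsum_in_other // dsum_in_other 1?eq_sym //.
  by rewrite linear0 add0r addr0 subrr.
rewrite addSn transportedS IH add0r.
rewrite -[X in phi _ X]/(val (dsum_in x) _ - val (dsum_in (phi k x)) _).
rewrite !dsum_in_other ?subrr ?linear0 // neq_ltn !addnS !ltnS ?leq_addl ?orbT //.
by rewrite (leq_trans (leq_addl d k)) ?leqnSn ?orbT.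
Qed.

(** An element that is zero in the limit becomes zero at some stage.  Its iterated
    images live in varying types, so what is known of [x] is carried along as a
    family [T] of predicates stable under the transition maps. *)
Lemma dirlim_in_eq0 (T : forall k, E k -> Prop) k (x : E k) :
    (forall k (x : E k), T k x -> T k.+1 (phi k x)) ->
    T k x -> dirlim_in x = 0 ->
  exists l, (k < l)%N /\ T l 0.
Proof.
move=> T_S Tx /eqP; rewrite -(linear0 (qproj (dirlim_rel phi))) qprojP subr0.
move=> /dirlim_rel_vanishing[K vK].
have Tl l : T (l + k.+1)%N (transported (val (dsum_in x)) (l + k.+1)).
  elim: l => [|l IH].
    rewrite add0n transportedS transported_in // dsum_in_self add0r.
    exact: T_S.
  rewrite addSn transportedS dsum_in_other ?addr0; first exact: T_S.
  by rewrite neq_ltn addnS ltnS leq_addl orbT.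
exists (K + k.+1)%N; split; first by rewrite addnS ltnS leq_addl.
by rewrite -(vK (K + k.+1)%N) ?leq_addr.
Qed.

End DirectLimits.
(** * Generalized local cohomology as a quotient of homomorphisms *)

Section Presentation.
Variables (R : comNzRingType) (a : ideal R) (M : lmodType R).
Hypothesis fgM : fg M.

Definition quot_pow_map k : {linear M -> quot_pow a M k} := qproj (pow_sub a M k).

Lemma quot_pow_map_surj k (x : quot_pow a M k) : exists m, quot_pow_map k m = x.
Proof. by exists (repr x); apply: qproj_surj. Qed.

Section Descent.
Variable V : lmodType R.

Definition descends k (h : hom_mod M (Gamma a V)) (h' : hom_mod (quot_pow a M k) V) :=
  forall m, of_hom h' (quot_pow_map k m) = val (of_hom h m).

Lemma descends_linear k : linear_rel (@descends k).
Proof.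
split=> [m|c h h' g g' hh' gg' m]; first by [].
by rewrite -[LHS]/(c *: of_hom h' _ + of_hom g' _) hh' gg'.
Qed.

Lemma descends_functional k : functional_rel (@descends k).
Proof.
move=> h' h'0; apply: hom_eqP => x; have [m <-] := quot_pow_map_surj x.
exact: h'0.
Qed.

Lemma descends_proj k h h' : descends h h' ->
  descends (k := k.+1) h (pullback (quot_pow_proj a M k) h').
Proof.
move=> hh' m; rewrite -hh' -[LHS]/(of_hom h' (quot_pow_proj a M k (quot_pow_map _ m))).
by congr (of_hom h' _); apply: quot_mapE.
Qed.

(** The values of [h] on a finite set of generators are killed by a common
    [a^k], so [h] is zero on [a^k M]. *)
Lemma descends_exists h : exists k h', descends (k := k) h h'.
Proof.
have [||m|k kP] := @torsion_bounded R a M V (full_sub M) (fun m z => of_hom h m = z) fgM.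
- split=> [|c m z m' z' <- <-]; first by rewrite linear0.
  by rewrite linearP.
- by move=> z; rewrite linear0 => ->.
- by exists (of_hom h m).
pose hV : {linear M -> V} := \val \o of_hom h.
have hker : {subset pow_sub a M k <= ker hV}.
  apply: gen_min => _ [r [m [rk _ ->]]]; rewrite inE linearZ /=.
  by apply/eqP; apply: (kP m (of_hom h m)).
have [||h' hh'] := @pullback_lift _ _ _ _ (quot_pow_map k) (to_hom hV).
- exact: quot_pow_map_surj.
- move=> m /eqP; rewrite -(linear0 (quot_pow_map k)) qprojP subr0.
  by move=> /hker; rewrite inE => /eqP.
exists k, h' => m.
exact: (congr1 (fun g : hom_mod M V => subm_val g m) hh').
Qed.

(** Values of a map defined on [M / a^k M] are killed by [a^k]. *)
Lemma descends_lift k h' : exists h, descends (k := k) h h'.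
Proof.
have h't m : of_hom h' (quot_pow_map k m) \in torsion a V.
  apply/asboolP; exists k => r rk; rewrite -!linearZ.
  have -> : quot_pow_map k (r *: m) = 0; last by rewrite linear0.
  apply/eqP; rewrite -(linear0 (quot_pow_map k)) qprojP subr0.
  by apply: sub_gen; exists r, m.
have lin_h : linear (fun m => Subm (h't m) : Gamma a V).
  move=> c m m'; apply: val_inj.
  by rewrite -[LHS]/(of_hom h' (quot_pow_map k (c *: m + m'))) !linearP.
pose h : {linear M -> Gamma a V} := HB.pack (fun m => Subm (h't m))
  (GRing.isLinear.Build R M (Gamma a V) *:%R _ lin_h).
by exists (to_hom h).
Qed.

End Descent.

(** [Hom(M, Gamma X_q)] is the direct limit of the [Hom(M / a^k M, X_q)], and an
    element of it becomes zero in the limit of the [Ext^q(M / a^k M, X_0)] exactly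
    when, at some finite stage, it lifts to [I_(q-1)]. *)
Lemma glc_of_hom_exists (D : coresolution R) q :
  exists s : {linear hom_mod M (Gamma a (D q)) -> glc a q M (D 0%N)},
    (forall e, exists h, s h = e) /\
    forall h, s h = 0 <-> exists g, push (Gamma_map a (cr_prev D q)) g = h.
Proof.
pose phi k := Ext_map q (D 0%N) (quot_pow_proj a M k).
pose cls k (h' : hom_mod (quot_pow a M k) (D q)) : glc a q M (D 0%N) :=
  dirlim_in phi (Ext_of_hom q D (quot_pow a M k) h').
have cls_lin k : linear (cls k) by move=> c h h'; rewrite /cls !linearP.
have cls0 k : cls k 0 = 0 by rewrite /cls !linear0.
have cls_le k l h h' : (k <= l)%N -> descends h h' ->
    exists2 h'', descends (k := l) h h'' & cls l h'' = cls k h'.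
  move=> /subnK <- hh'; elim: (l - k)%N => [|d [h'' hh'' <-]]; first by exists h'.
  exists (pullback (quot_pow_proj a M _) h''); first exact: descends_proj.
  by rewrite /cls Ext_of_hom_natural; apply: dirlim_in_phi.
pose G h e := exists k h', descends (k := k) h h' /\ cls k h' = e.
have [|||s sP] := @graph_linear _ _ _ G.
- split; first by exists 0%N, 0; split=> //; case: (descends_linear (D q) 0).
  move=> c h _ g _ [k [h' [hh' <-]]] [l [g' [gg' <-]]].
  have [h2 hh2 <-] := cls_le _ _ _ _ (leq_maxl k l) hh'.
  have [g2 gg2 <-] := cls_le _ _ _ _ (leq_maxr k l) gg'.
  exists (maxn k l), (c *: h2 + g2); rewrite cls_lin; split=> //.
  exact: (descends_linear _ _).2.
- by move=> e [k [h' [/descends_functional -> <-]]].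
- by move=> h; have [k [h' hh']] := descends_exists h; exists (cls k h'), k, h'.
exists s; split=> [e|h].
  have [k [x <-]] := dirlim_in_surj e.
  have [h' <-] := Ext_of_hom_surj x; have [h hh'] := descends_lift h'.
  by exists h; apply/sP; exists k, h'.
split=> [/sP[k [h' [hh' cls_h']]]|[g <-]].
  pose T l x := exists2 h'', descends (k := l) h h'' & Ext_of_hom q D _ h'' = x.
  have [||l [_ [h'' hh'' /Ext_of_hom_ker[g' gh'']]]] := @dirlim_in_eq0 _ _ phi T _ _ _ _ cls_h'.
  - move=> l _ [h'' hh'' <-]; exists (pullback (quot_pow_proj a M _) h'').
      exact: descends_proj.
    exact: Ext_of_hom_natural.
  - by exists h'.
  have [g gg'] := descends_lift g'; exists g; apply: hom_eqP => m; apply: val_inj.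
  rewrite -[RHS]hh'' -gh''.
  by rewrite -[LHS]/(cr_prev D q (val (of_hom g m))) -gg'.
have [k [g' gg']] := descends_exists g.
apply/sP; exists k, (push (cr_prev D q) g'); split.
  by move=> m; rewrite -[LHS]/(cr_prev D q (of_hom g' _)) gg'.
rewrite -(linear0 (dirlim_in phi (k := k))); congr (dirlim_in phi).
by apply/Ext_of_hom_ker; exists g'.
Qed.

Lemma glc_of_Ext0_exists (D : coresolution R) q :
  exists s : {linear Ext 0 M (Gamma a (D q)) -> glc a q M (D 0%N)},
    (forall e, exists x, s x = e) /\
    forall x, s x = 0 <-> exists y, Ext_push 0 M (Gamma_map a (cr_prev D q)) y = x.
Proof.
have [s [s_surj s_ker]] := glc_of_hom_exists D q.
have [|||t tP] := @graph_linear _ _ _ (fun x e => exists2 h, hom_Ext0 h = x & s h = e).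
- split; first by exists 0; rewrite linear0.
  move=> c _ _ _ _ [h <- <-] [g <- <-].
  by exists (c *: h + g); rewrite linearP.
- by move=> e [h /hom_Ext0_inj -> <-]; rewrite linear0.
- by move=> x; have [h hx] := hom_Ext0_surj x; exists (s h), h.
exists t; split=> [e|x].
  by have [h he] := s_surj e; exists (hom_Ext0 h); apply/tP; exists h.
split=> [/tP[h <- /s_ker[g <-]]|[y <-]].
  by exists (hom_Ext0 g); rewrite hom_Ext0_push.
have [g <-] := hom_Ext0_surj y; apply/tP.
exists (push (Gamma_map a (cr_prev D q)) g); first by rewrite hom_Ext0_push.
by apply/s_ker; exists g.
Qed.

End Presentation.

Section LocalCohomologyPresentation.
Variables (R : comNzRingType) (a : ideal R).

Lemma fg_ring : fg (R^o).
Proof.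
exists [:: 1] => r; apply/esym/asboolP => N N1.
have {}N1 : (1 : R) \in N by apply: N1; rewrite mem_head.
by rewrite -[r]mulr1; apply: idealMl.
Qed.

(** The case [M = R], where homomorphisms are evaluated at [1]. *)
Lemma lc_presentation (D : coresolution R) q :
  exists s : {linear Gamma a (D q) -> lc a q (D 0%N)},
    (forall e, exists z, s z = e) /\
    forall z, s z = 0 <-> exists y, Gamma_map a (cr_prev D q) y = z.
Proof.
have [s [s_surj s_ker]] := @glc_of_hom_exists _ a _ fg_ring D q.
have scale_lin (V : lmodType R) (z : V) : linear (fun r : R^o => r *: z).
  by move=> c r r'; rewrite scalerDl scalerA.
pose orbit (V : lmodType R) (z : V) : {linear R^o -> V} := HB.pack (fun r : R^o => r *: z)
  (GRing.isLinear.Build R R^o V *:%R _ (scale_lin V z)).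
have hom_orbit (V : lmodType R) (h : hom_mod R^o V) : to_hom (orbit V (of_hom h 1)) = h.
  apply: hom_eqP => r; rewrite -[LHS]/(r *: of_hom h 1) -linearZ.
  by rewrite /GRing.scale /= mulr1.
have t_lin : linear (fun z : Gamma a (D q) => s (to_hom (orbit _ z)) : lc a q (D 0%N)).
  move=> c z z'; rewrite -linearP; congr (s _); apply: hom_eqP => r.
  rewrite -[LHS]/(r *: (c *: z + z')) -[RHS]/(c *: (r *: z) + r *: z').
  by rewrite scalerDr !scalerA mulrC.
pose t : {linear Gamma a (D q) -> lc a q (D 0%N)} :=
  HB.pack (fun z : Gamma a (D q) => s (to_hom (orbit _ z)))
    (GRing.isLinear.Build R (Gamma a (D q)) (lc a q (D 0%N)) *:%R _ t_lin).
exists t; split=> [e|z].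
  by have [h <-] := s_surj e; exists (of_hom h 1); rewrite /= hom_orbit.
rewrite [t z = 0]s_ker; split=> [[g gz]|[y <-]].
  exists (of_hom g 1); rewrite -[RHS](scale1r z).
  exact: (congr1 (fun k : hom_mod R^o _ => subm_val k 1) gz).
exists (to_hom (orbit _ y)); apply: hom_eqP => r.
by rewrite -[LHS]/(Gamma_map a (cr_prev D q) (r *: y)) linearZ.
Qed.

End LocalCohomologyPresentation.
(** * The exact couple *)

Section Isomorphisms.
Variable R : comNzRingType.
Implicit Types U V W : lmodType R.

Lemma isomorphic_of_bij V W (f : {linear V -> W}) :
  (forall v, f v = 0 -> v = 0) -> (forall w, exists v, f v = w) -> isomorphic V W.
Proof.
move=> f0 fs; exists f; have [g fg] := choice fs.
have f_inj v v' : f v = f v' -> v = v'.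
  move=> fv; apply/eqP; rewrite -subr_eq0; apply/eqP/f0.
  by rewrite linearB fv subrr.
by exists g => // v; apply: f_inj.
Qed.

Lemma isomorphic_coimage U V W (f : {linear U -> V}) (g : {linear U -> W}) :
  (forall v, exists u, f u = v) -> (forall w, exists u, g u = w) ->
  (forall u, f u = 0 <-> g u = 0) -> isomorphic V W.
Proof.
move=> fs gs fg.
have [|||h hP] := @graph_linear _ _ _ (fun v w => exists2 u, f u = v & g u = w).
- split; first by exists 0; rewrite linear0.
  move=> c _ _ _ _ [u <- <-] [u' <- <-].
  by exists (c *: u + u'); rewrite linearP.
- by move=> w [u /fg + <-].
- by move=> v; have [u uv] := fs v; exists (g u), u.
apply: (isomorphic_of_bij (f := h)) => [v /hP[u <- /fg]|w] //.
by have [u <-] := gs w; exists (f u); apply/hP; exists u.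
Qed.

Lemma isomorphic_sym V W : isomorphic V W -> isomorphic W V.
Proof.
case=> f [g fK gK]; have gl : linear g.
  by move=> c u v; apply: (can_inj fK); rewrite linearP !gK.
pose G : {linear W -> V} := HB.pack g (GRing.isLinear.Build R W V *:%R g gl).
by exists G, f.
Qed.

Lemma isomorphic_trans U V W : isomorphic U V -> isomorphic V W -> isomorphic U W.
Proof. by case=> f bf [g bg]; exists (g \o f); apply: bij_comp. Qed.

Lemma isomorphic_zero V W : isomorphic V W -> is_zero V -> is_zero W.
Proof. by case=> f [g fK gK] V0 w; rewrite -(gK w) (V0 (g w)) linear0. Qed.

End Isomorphisms.

Section ExactCouple.
Variables (R : comNzRingType) (a : ideal R) (D : coresolution R).
Variable M : lmodType R.
Hypotheses (noethR : noetherian R) (fgM : fg M).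

Let Z q := Gamma a (D q).
Let Y q := Gamma a (cr_inj D q).
Let H q := lc a q (D 0%N).
Let d q : {linear Y q.-1 -> Z q} := Gamma_map a (cr_prev D q).

Definition torsion_boundary q : lmodType R := subm (im (d q)).
Let B := torsion_boundary.
Let iB q : {linear B q -> Z q} := \val.

Fact to_boundary_proof q y : d q y \in im (d q).
Proof. by apply/asboolP; exists y. Qed.
Definition to_boundary q (y : Y q.-1) : B q := Subm (to_boundary_proof y).
Fact to_boundary_linear q : linear (@to_boundary q).
Proof. by move=> c y y'; apply: val_inj; apply: linearP. Qed.
HB.instance Definition _ q := GRing.isLinear.Build R (Y q.-1) (B q) *:%R
  (@to_boundary q) (@to_boundary_linear q).
Let e q : {linear Y q.-1 -> B q} := @to_boundary q.

(** [Gamma] is left exact: an element of [X_q] whose image in [I_q] is torsion is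
    itself torsion. *)
Lemma torsion_cocycle_exact q :
  short_exact (Gamma_map a (cr_in D q) : {linear Z q -> Y q})
    (e q.+1).
Proof.
have [in0 in_out _] := cr_exact D q; split.
- move=> z /(congr1 val) z0; apply: Gamma_val0; apply: in0; exact: z0.
- move=> y; split=> [/(congr1 (fun b => val (val b)))|[z <-]]; last first.
    apply/val_inj/val_inj; exact: (short_exact_comp0 _ (cr_exact D q)).
  move=> /= /in_out[x xy]; have xt : x \in torsion a (D q).
    have /asboolP[k ky] := valP y; apply/asboolP; exists k => r rk.
    by apply: in0; rewrite linearZ xy; apply: ky.
  by exists (Subm xt); apply: val_inj.
- move=> b; have /asboolP[y yb] := valP b.
  by exists y; apply: val_inj.
Qed.

Lemma torsion_boundary_exact q :
  exists p : {linear Z q -> H q}, short_exact (iB q) p.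
Proof.
have [p [ps pk]] := lc_presentation a D q; exists p; split=> //.
  by move=> b b0; apply: val_inj.
move=> z; rewrite pk; split=> [[y yz]|[b <-]].
  by exists (to_boundary y); apply: yz.
exact/asboolP/(valP b).
Qed.

Lemma torsion_boundary0 : is_zero (B 0).
Proof.
move=> b; have /asboolP[y yb] := valP b.
by apply: val_inj; rewrite -yb; apply: val_inj.
Qed.

Lemma Ext_push_boundary p q y :
  Ext_push p M (d q) y =
  Ext_push p M (iB q) (Ext_push p M (e q) y).
Proof.
have [z zy] := class_repr y.
apply: (cohomology_map_eq zy).
have /(has_class_map (hom_push M (iB q))) := has_class_map (hom_push M (e q)) zy.
by congr has_class; apply: hom_eqP.
Qed.

Lemma Ext_torsion_injective p q x : x = 0 :> Ext p.+1 M (Y q).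
Proof. exact/Ext_injective/Gamma_injective/cr_injective. Qed.

Lemma Ext_boundary_shift p q :
  isomorphic (Ext p.+1 M (B q.+1)) (Ext p.+2 M (Z q)).
Proof.
apply: (isomorphic_of_bij (f := Ext_delta M (torsion_cocycle_exact q) p.+1)).
  by move=> x /Ext_delta_ker[y <-]; rewrite (Ext_torsion_injective y) linear0.
by move=> x; apply/Ext_delta_im; apply: Ext_torsion_injective.
Qed.

(** Going down from [B_q] to [B_0 = 0], each step meets one
    [Ext^(p+1+q-r)(M, H^r)] with [r < q]. *)
Lemma Ext_boundary_zero q p :
  (forall r, (r < q)%N -> is_zero (Ext (p.+1 + q - r) M (H r))) ->
  is_zero (Ext p.+1 M (B q)).
Proof.
elim: q p => [|q IH] p H0; first by move=> x; apply: Ext_push_zero torsion_boundary0.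
apply: (isomorphic_zero (isomorphic_sym (Ext_boundary_shift p q))) => x.
have [pi ex] := torsion_boundary_exact q.
have : Ext_push p.+2 M pi x = 0.
  by have := H0 q (ltnSn q); rewrite -addSnnS addnK; apply.
move=> /(Ext_push_mid ex)[b <-]; rewrite (IH p.+1 _ b) ?linear0 // => r rq.
by rewrite addSnnS; apply: H0; rewrite ltnW.
Qed.

Lemma Ext_cocycle_zero q p :
  (forall r, (r <= q)%N -> is_zero (Ext (p.+1 + q - r) M (H r))) ->
  is_zero (Ext p.+1 M (Z q)).
Proof.
move=> H0 x; have [pi ex] := torsion_boundary_exact q.
have : Ext_push p.+1 M pi x = 0.
  by have := H0 q (leqnn q); rewrite addnK; apply.
move=> /(Ext_push_mid ex)[b <-]; rewrite (Ext_boundary_zero _ b) ?linear0 //.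
by move=> r rq; apply: H0; rewrite ltnW.
Qed.

(** The map [D^(p+2,q) -> D^(p+1,q+1)] of the exact couple; the two hypotheses are
    its neighbours in the long exact sequence. *)
Lemma Ext_cocycle_step p q :
  is_zero (Ext p M (H q.+1)) -> is_zero (Ext p.+1 M (H q.+1)) ->
  isomorphic (Ext p.+1 M (Z q.+1)) (Ext p.+2 M (Z q)).
Proof.
move=> Hp Hp1; apply: isomorphic_trans (Ext_boundary_shift p q).
apply: isomorphic_sym; have [pi ex] := torsion_boundary_exact q.+1.
apply: (isomorphic_of_bij (f := Ext_push p.+1 M (iB q.+1))) => [b|x].
  by move=> /(Ext_delta_im ex)[x <-]; rewrite (Hp x) linear0.
exact/(Ext_push_mid ex)/Hp1.
Qed.

(** The map [D^(1,q) -> D^(0,q+1)].  Both sides are quotients of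
    [Hom(M, B_(q+1))], by the same image of [Hom(M, Y_q)]. *)
Lemma glc_cocycle q : is_zero (Ext 0 M (H q.+1)) ->
  isomorphic (glc a q.+1 M (D 0%N)) (Ext 1 M (Z q)).
Proof.
move=> H0; have [s [ss sk]] := glc_of_Ext0_exists a fgM D q.+1.
have [pi ex] := torsion_boundary_exact q.+1.
have iB_surj x : exists b, Ext_push 0 M (iB q.+1) b = x.
  exact/(Ext_push_mid ex)/H0.
apply: (isomorphic_coimage (f := s \o Ext_push 0 M (iB q.+1))
  (g := Ext_delta M (torsion_cocycle_exact q) 0)).
- by move=> y; have [x <-] := ss y; have [b <-] := iB_surj x; exists b.
- by move=> x; apply/Ext_delta_im; apply: Ext_torsion_injective.
move=> b; rewrite Ext_delta_ker [(s \o _) b = 0]sk.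
split=> [[y]|[y <-]]; last by exists y; apply: Ext_push_boundary.
rewrite [LHS]Ext_push_boundary => yb; exists y.
apply/eqP; rewrite -subr_eq0; apply/eqP/(Ext0_push_inj ex).
by rewrite linearB; apply/eqP; rewrite subr_eq0; apply/eqP.
Qed.

Lemma Ext_cocycle_cohomology p q :
  is_zero (Ext p M (B q)) -> is_zero (Ext p.+1 M (B q)) ->
  isomorphic (Ext p M (Z q)) (Ext p M (H q)).
Proof.
move=> Bp Bp1; have [pi ex] := torsion_boundary_exact q.
apply: (isomorphic_of_bij (f := Ext_push p M pi)) => [x|x].
  by move=> /(Ext_push_mid ex)[b <-]; rewrite (Bp b) linear0.
exact/(Ext_delta_ker ex)/Bp1.
Qed.

(** Both sides are quotients of [Hom(M, Z_q)], by the images of [Hom(M, Y_(q-1))]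
    and of [Hom(M, B_q)]; the obstruction to lifting from [B_q] to [Y_(q-1)] lies
    in [Ext^1(M, Z_(q-1))]. *)
Lemma glc_cohomology q : is_zero (Ext 1 M (B q)) ->
  (forall p, q = p.+1 -> is_zero (Ext 1 M (Z p))) ->
  isomorphic (glc a q M (D 0%N)) (Ext 0 M (H q)).
Proof.
move=> B1 Z1; have [s [ss sk]] := glc_of_Ext0_exists a fgM D q.
have [pi ex] := torsion_boundary_exact q.
apply: (isomorphic_coimage (f := s) (g := Ext_push 0 M pi)) => // [x|x].
  exact/(Ext_delta_ker ex)/B1.
rewrite sk (Ext_push_mid ex); split=> [[y <-]|[b <-]].
  by exists (Ext_push 0 M (e q) y);
     rewrite [RHS]Ext_push_boundary.
suff [y <-] : exists y, Ext_push 0 M (e q) y = b.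
  by exists y; apply: Ext_push_boundary.
case: q Z1 b {B1 s ss sk pi ex x} => [|q] Z1 b.
  by exists 0; rewrite linear0 (Ext_push_zero b torsion_boundary0).
by apply/(Ext_delta_ker (torsion_cocycle_exact q)); apply: Z1.
Qed.

End ExactCouple.

Theorem theorem2p21 (R : comNzRingType) (noethR : noetherian R) (a : ideal R)
    (M X : lmodType R) (fgM : fg M) (m n : nat)
    (h1 : forall r : nat, (r < n)%N || (n < r <= m + n)%N ->
      is_zero (Ext (m + n - r)%N M (lc a r X)))
    (h2 : forall r : nat, (1 <= r <= n)%N ->
      is_zero (Ext (m + 1 + r)%N M (lc a (n - r)%N X)))
    (h3 : forall r : nat, (1 <= r < m)%N ->
      is_zero (Ext (m - 1 - r)%N M (lc a (n + r)%N X))) :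
  isomorphic (glc a (m + n)%N M X) (Ext m M (lc a n X)).
Proof.
pose D := cofree_coresolution X.
have B2 : is_zero (Ext m.+1 M (torsion_boundary a D n)).
  apply: Ext_boundary_zero => // r rn.
  have := h2 (n - r)%N; rewrite subn_gt0 rn leq_subr subKn ?(ltnW rn) // => /(_ isT).
  by rewrite addn1 addnBA // ltnW.
have [m0|m_gt0] := posnP m.
  move: B2 h1; rewrite m0 !add0n => B2 h1.
  apply: (@glc_cohomology R a D M fgM n B2) => p np.
  apply: Ext_cocycle_zero => // r rp.
  by rewrite add1n -np; apply: h1; rewrite np ltnS rp.
(* The walk along the antidiagonal from [D^(0,m+n)] to [D^(m,n)], stopped at
   [D^(j+1,q)]. *)
have chain j k q : (j.+1 + k = m)%N -> q = (n + k)%N ->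
    isomorphic (glc a (m + n) M X) (Ext j.+1 M (Gamma a (D q))).
  elim: j k q => [|j IH] k q jk qE.
    have -> : (m + n = q.+1)%N by lia.
    apply: (@glc_cocycle R a D M noethR fgM q).
    have := h1 q.+1; have -> : (m + n - q.+1 = 0)%N by lia.
    by apply; lia.
  apply: isomorphic_trans (Ext_cocycle_step noethR (D := D) (p := j) (q := q) _ _).
  - by apply: (IH k.+1); lia.
  - have := h3 k.+1; have -> : (m - 1 - k.+1 = j)%N by lia.
    by have -> : (n + k.+1 = q.+1)%N by [lia]; apply; lia.
  - have := h1 q.+1; have -> : (m + n - q.+1 = j.+1)%N by lia.
    by apply; lia.
case: m m_gt0 h1 B2 chain {h2 h3} => // m _ h1 B2 chain.
have := chain m 0%N n; rewrite !addn0 => /(_ erefl erefl) /isomorphic_trans; apply.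
apply: Ext_cocycle_cohomology => //.
by apply: Ext_boundary_zero => // r rn; apply: h1; rewrite rn.
Qed.
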